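(* Let $K$ be a commutative unital ring and $G$ a group. If $G$ is finite or countable, then $cd^{par}_K(G)=cd_K(G)$. If $G$ is infinite uncountable, then $$cd^{par}_K(G)\le cd_K(G)+pd_{K_{par}G}(KG\otimes_{G_{par}}K_{par}G).$$
   Context: $K$ is a fixed commutative unital ring; $\otimes=\otimes_K$; $G$ is a group. $\mathcal S(G)$ is the (inverse) monoid with generators $[t]$, $t\in G$, and relations $[1_G]=1$, $[s^{-1}][s][t]=[s^{-1}][st]$, $[s][t][t^{-1}]=[st][t^{-1}]$. $K_{par}G$ is the semigroup $K$-algebra of $\mathcal S(G)$; $e_g:=[g][g^{-1}]$ are commuting idempotents. $\mathcal B\subseteq K_{par}G$ is the semigroup $K$-algebra of the idempotent semigroup $E(\mathcal S(G))$, which is generated by the $e_g$. $\mathcal B$ is a right $K_{par}G$-module via $u\triangleleft[g]=[g^{-1}]u[g]$. The partial cohomological dimension $cd^{par}_K(G)$ is the projective dimension of $\mathcal B$ as a right $K_{par}G$-module; equivalently, the largest $n$ such that $H^n_{par}(G,M):=\operatorname{Ext}^n_{K_{par}G}(\mathcal B,M)\neq0$ for some right $K_{par}G$-module $M$ (and $\infty$ if there is no largest such $n$). $cd_K(G)$ is the usual cohomological dimension of $G$ over $K$, i.e. the projective dimension of the trivial module $K$ over $KG$. $pd_{K_{par}G}$ denotes projective dimension of right $K_{par}G$-modules. $KG\otimes_{G_{par}}K_{par}G$ is the quotient of $KG\otimes K_{par}G$ by the $K$-submodule generated by all $gh\otimes e_{h^{-1}}z-g\otimes[h]z$ ($g,h\in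 G$, $z\in K_{par}G$), a right $K_{par}G$-module by right multiplication on the second factor. *)

(* Defs.v *)
From HB Require Import structures.
From mathcomp Require Import all_boot all_order all_algebra.
From mathcomp Require Import finmap.
From mathcomp Require Import boolp classical_sets cardinality constructive_ereal.

Set Implicit Arguments.
Unset Strict Implicit.
Unset Printing Implicit Defensive.

Import GRing.Theory.

Local Open Scope ring_scope.
Local Open Scope classical_set_scope.

(* A right R-module is an lmodType over the converse ring R^c; there a *: v    *)
(* stands for v.a, and (a *: (b *: v)) = ((b * a : R) *: v).                   *)
Notation rmodType R := (lmodType R^c).

Definition projective_module (R : pzRingType) (P : lmodType R) : Prop :=
  forall (A B : lmodType R) (p : {linear A -> B}) (f : {linear P -> B}),
    (forall b, exists a, p a = b) ->
    exists g : {linear P -> A}, forall x, p (g x) = f x.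

Definition projective_resolution_le (R : pzRingType) (M : lmodType R)
    (n : nat) : Prop :=
  exists (P : nat -> lmodType R) (d : forall i, {linear P i.+1 -> P i})
         (eps : {linear P 0 -> M}),
    [/\ forall i, projective_module (P i),
        forall m, exists x, eps x = m,
        forall x, eps x = 0 <-> exists y, d 0 y = x,
        forall i x, d i x = 0 <-> exists y, d i.+1 y = x
      & forall i, (n < i)%N -> forall x : P i, x = 0].

(* The zero module gets dimension 0. *)
Definition projdim (R : pzRingType) (M : lmodType R) : \bar int :=
  match pselect (exists n, `[< projective_resolution_le M n >]) with
  | left ex => (Posz (ex_minn ex))%:E
  | right _ => +oo%E
  end.

(* Locking with this key only keeps unification from unfolding a definition.  *)
Fact lock_key : unit. Proof. exact: tt. Qed.

Section Span.
Context (K : pzRingType) (V : lmodType K).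
Implicit Types (S N : set V).

Definition is_submodule N : Prop :=
  N 0 /\ forall (k : K) u v, N u -> N v -> N (k *: u + v).

Definition span S : set V :=
  [set v | forall N, is_submodule N -> S `<=` N -> N v].

Lemma sub_span S : S `<=` span S.
Proof. by move=> v Sv N _; apply. Qed.

Lemma span_submod S : is_submodule (span S).
Proof.
split=> [N [] //|k u v Su Sv N Nsub SN].
by apply: Nsub.2; [apply: Su|apply: Sv].
Qed.

Lemma span_min S N : is_submodule N -> S `<=` N -> span S `<=` N.
Proof. by move=> Nsub SN v; apply. Qed.

Lemma span0 S : span S 0. Proof. exact: (span_submod S).1. Qed.

Lemma spanZD S k u v : span S u -> span S v -> span S (k *: u + v).
Proof. exact: (span_submod S).2. Qed.

Lemma spanD S u v : span S u -> span S v -> span S (u + v).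
Proof. by move=> Su Sv; rewrite -[u]scale1r; apply: spanZD. Qed.

Lemma spanZ S k u : span S u -> span S (k *: u).
Proof. by move=> Su; rewrite -[_ *: _]addr0; apply: spanZD => //; apply: span0. Qed.

Lemma spanN S u : span S u -> span S (- u).
Proof. by rewrite -scaleN1r; apply: spanZ. Qed.

Definition quot_rel S : rel V := fun u v => `[< span S (u - v) >].

Lemma quot_rel_refl S : reflexive (quot_rel S).
Proof. by move=> u; apply/asboolP; rewrite subrr; apply: span0. Qed.

Lemma quot_rel_sym S : symmetric (quot_rel S).
Proof.
by move=> u v; apply/asboolP/asboolP => /spanN; rewrite opprB.
Qed.

Lemma quot_rel_trans S : transitive (quot_rel S).
Proof.
move=> v u w /asboolP uv /asboolP vw; apply/asboolP.
by have := spanD uv vw; rewrite addrA subrK.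
Qed.

Canonical quot_equiv S :=
  EquivRel (quot_rel S) (quot_rel_refl S) (quot_rel_sym S) (@quot_rel_trans S).

Definition quotmod S := {eq_quot quot_equiv S}%qT.

HB.instance Definition _ S := Choice.on (quotmod S).
HB.instance Definition _ S := EqQuotient.on (quotmod S).

Definition qpi S : V -> quotmod S :=
  locked_with lock_key (fun v => \pi_(quotmod S)%qT v).

Lemma qpiE S v : qpi S v = \pi_(quotmod S)%qT v.
Proof. by rewrite /qpi unlock. Qed.

End Span.

Section QuotMod.
Context (K : pzRingType) (V : lmodType K) (S : set V).
Local Notation Q := (quotmod S).
Local Notation pi := (qpi S).

Lemma qpiP u v : pi u = pi v <-> span S (u - v).
Proof.
split=> [/eqP|h].
  by rewrite !qpiE eqmodE => /asboolP.
by apply/eqP; rewrite !qpiE eqmodE; apply/asboolP.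
Qed.

Lemma qreprK (x : Q) : pi (repr x) = x.
Proof. by rewrite qpiE reprK. Qed.

Lemma qpi_ind (P : Q -> Prop) : (forall v, P (pi v)) -> forall x, P x.
Proof. by move=> h x; rewrite -(qreprK x). Qed.

Definition qadd (x y : Q) : Q := pi (repr x + repr y).
Definition qopp (x : Q) : Q := pi (- repr x).
Definition qscale (k : K) (x : Q) : Q := pi (k *: repr x).

Lemma qrepr_pi v : span S (repr (pi v) - v).
Proof. by apply/qpiP; rewrite qreprK. Qed.

Lemma qaddE u v : qadd (pi u) (pi v) = pi (u + v).
Proof.
apply/qpiP; have := spanD (qrepr_pi u) (qrepr_pi v).
by rewrite addrACA -opprD.
Qed.

Lemma qoppE u : qopp (pi u) = pi (- u).
Proof. by apply/qpiP; have := spanN (qrepr_pi u); rewrite opprB opprK addrC. Qed.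

Lemma qscaleE k u : qscale k (pi u) = pi (k *: u).
Proof. by apply/qpiP; have := spanZ k (qrepr_pi u); rewrite scalerBr. Qed.

Fact qaddA : associative qadd.
Proof.
by elim/qpi_ind=> u; elim/qpi_ind=> v; elim/qpi_ind=> w; rewrite !qaddE addrA.
Qed.

Fact qaddC : commutative qadd.
Proof. by elim/qpi_ind=> u; elim/qpi_ind=> v; rewrite !qaddE addrC. Qed.

Fact qadd0 : left_id (pi 0) qadd.
Proof. by elim/qpi_ind=> u; rewrite qaddE add0r. Qed.

Fact qaddN : left_inverse (pi 0) qopp qadd.
Proof. by elim/qpi_ind=> u; rewrite qoppE qaddE addNr. Qed.

HB.instance Definition _ := GRing.isZmodule.Build Q qaddA qaddC qadd0 qaddN.

Fact qscaleA a b v : qscale a (qscale b v) = qscale (a * b) v.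
Proof. by elim/qpi_ind: v => v; rewrite !qscaleE scalerA. Qed.

Fact qscale1 : left_id 1 qscale.
Proof. by elim/qpi_ind=> v; rewrite qscaleE scale1r. Qed.

Fact qscaleDr : right_distributive qscale +%R.
Proof.
move=> k; elim/qpi_ind=> u; elim/qpi_ind=> v.
by rewrite [_ + _]qaddE !qscaleE [RHS]qaddE scalerDr.
Qed.

Fact qscaleDl v : {morph qscale^~ v : a b / a + b}.
Proof.
move=> a b; elim/qpi_ind: v => v.
by rewrite !qscaleE [RHS]qaddE scalerDl.
Qed.

HB.instance Definition _ :=
  GRing.Zmodule_isLmodule.Build K Q qscaleA qscale1 qscaleDr qscaleDl.

Fact qpi_linear : linear pi.
Proof. by move=> k u v; rewrite [k *: pi u]qscaleE [RHS]qaddE. Qed.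

HB.instance Definition _ := GRing.isLinear.Build K V Q _ pi qpi_linear.

Lemma qpi0 v : pi v = 0 <-> span S v.
Proof. by rewrite -[v in span S v]subr0; apply: qpiP. Qed.

(* The map induced on the quotient by a linear h that kills S. *)
Definition qlift (W : Type) : (V -> W) -> Q -> W :=
  locked_with lock_key (fun h x => h (repr x)).

Lemma qliftE (W : lmodType K) (h : {linear V -> W}) :
  (forall s, S s -> h s = 0) -> forall v, qlift h (pi v) = h v.
Proof.
move=> h0 v; apply/eqP; rewrite -subr_eq0 /qlift unlock -raddfB; apply/eqP.
apply: (@span_min _ _ S [set w | h w = 0]) (qrepr_pi v) => //.
split=> [|k u w /= hu hw]; rewrite /= ?raddf0//.
by rewrite linearP hu hw scaler0 add0r.
Qed.

End QuotMod.

Definition freemod (K : pzRingType) (T : choiceType) : Type :=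
  {fsfun T -> K with 0}.

Section FreeMod.
Context (K : pzRingType) (T : choiceType).
Local Notation F := (freemod K T).
Local Open Scope fset_scope.
Local Open Scope ring_scope.

HB.instance Definition _ := Choice.on F.

Implicit Types f g : F.

Definition coef (t : T) (f : F) : K := (f : {fsfun T -> K with 0}) t.
Definition supp (f : F) : {fset T} := finsupp (f : {fsfun T -> K with 0}).

Lemma freemodP f g : (forall t, coef t f = coef t g) <-> f = g.
Proof. exact: (fsfunP (f : {fsfun _ -> _ with _}) g). Qed.

Lemma mem_supp f t : (t \in supp f) = (coef t f != 0).
Proof. exact: mem_finsupp. Qed.

Definition fm0 : F := [fsfun].
Definition fmadd : F -> F -> F := locked_with lock_key (fun f g =>
  [fsfun t in supp f `|` supp g => (coef t f + coef t g)%R]).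
Definition fmopp : F -> F := locked_with lock_key (fun f =>
  [fsfun t in supp f => - coef t f]).
Definition fmscale : K -> F -> F := locked_with lock_key (fun k f =>
  [fsfun t in supp f => k * coef t f]).
Definition single : T -> F := locked_with lock_key (fun t =>
  [fsfun x in [fset t] => 1]).

Let coef_out f t : t \notin supp f -> coef t f = 0.
Proof. by rewrite mem_supp negbK => /eqP. Qed.

Lemma coef_fm0 t : coef t fm0 = 0.
Proof. by rewrite /coef /fm0 fsfunE. Qed.

Lemma coef_fmadd f g t : coef t (fmadd f g) = coef t f + coef t g.
Proof.
rewrite /fmadd unlock {1}/coef fsfunE inE; case: ifPn => // /norP[/coef_out-> /coef_out->].
by rewrite addr0.
Qed.

Lemma coef_fmopp f t : coef t (fmopp f) = - coef t f.
Proof.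
rewrite /fmopp unlock {1}/coef fsfunE.
by case: ifPn => // /coef_out->; rewrite oppr0.
Qed.

Lemma coef_fmscale k f t : coef t (fmscale k f) = k * coef t f.
Proof.
rewrite /fmscale unlock {1}/coef fsfunE.
by case: ifPn => // /coef_out->; rewrite mulr0.
Qed.

Lemma coef_single t x : coef x (single t) = (x == t)%:R.
Proof. by rewrite /single unlock /coef fsfunE inE; case: eqP. Qed.

Fact fmaddA : associative fmadd.
Proof. by move=> f g h; apply/freemodP => t; rewrite !coef_fmadd addrA. Qed.
Fact fmaddC : commutative fmadd.
Proof. by move=> f g; apply/freemodP => t; rewrite !coef_fmadd addrC. Qed.
Fact fmadd0 : left_id fm0 fmadd.
Proof. by move=> f; apply/freemodP => t; rewrite coef_fmadd coef_fm0 add0r. Qed.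
Fact fmaddN : left_inverse fm0 fmopp fmadd.
Proof.
by move=> f; apply/freemodP => t; rewrite coef_fmadd coef_fmopp coef_fm0 addNr.
Qed.

HB.instance Definition _ := GRing.isZmodule.Build F fmaddA fmaddC fmadd0 fmaddN.

Fact fmscaleA a b f : fmscale a (fmscale b f) = fmscale (a * b) f.
Proof. by apply/freemodP => t; rewrite !coef_fmscale mulrA. Qed.
Fact fmscale1 : left_id 1 fmscale.
Proof. by move=> f; apply/freemodP => t; rewrite coef_fmscale mul1r. Qed.
Fact fmscaleDr : right_distributive fmscale +%R.
Proof.
move=> k f g; apply/freemodP => t.
by rewrite coef_fmscale [f + g]/(fmadd f g) [RHS]coef_fmadd coef_fmadd !coef_fmscale mulrDr.
Qed.
Fact fmscaleDl f : {morph fmscale^~ f : a b / a + b}.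
Proof.
move=> a b; apply/freemodP => t.
by rewrite coef_fmscale [RHS]coef_fmadd !coef_fmscale mulrDl.
Qed.

HB.instance Definition _ :=
  GRing.Zmodule_isLmodule.Build K F fmscaleA fmscale1 fmscaleDr fmscaleDl.

Lemma coefD t f g : coef t (f + g) = coef t f + coef t g.
Proof. exact: coef_fmadd. Qed.
Lemma coefZ t k f : coef t (k *: f) = k * coef t f.
Proof. exact: coef_fmscale. Qed.

Fact coef_semilinear t : linear_for *%R (coef t).
Proof. by move=> k f g; rewrite coefD coefZ. Qed.

HB.instance Definition _ t :=
  GRing.isLinear.Build K F K *%R (coef t) (coef_semilinear t).

Definition flift (V : lmodType K) : (T -> V) -> F -> V :=
  locked_with lock_key (fun phi f => \sum_(t <- supp f) coef t f *: phi t).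

Lemma fliftE (V : lmodType K) (phi : T -> V) f :
  flift phi f = \sum_(t <- supp f) coef t f *: phi t.
Proof. by rewrite /flift unlock. Qed.

Section Lift.
Context (V : lmodType K) (phi : T -> V).

Lemma flift_sub (A : {fset T}) f : supp f `<=` A ->
  flift phi f = \sum_(t <- A) coef t f *: phi t.
Proof.
move=> sfA; rewrite fliftE; apply: big_fset_incl => // t _ /coef_out ->.
by rewrite scale0r.
Qed.

Fact flift_linear : linear (flift phi).
Proof.
move=> k f g; set A := supp f `|` supp g `|` supp (k *: f + g).
rewrite (@flift_sub A f) ?(@flift_sub A g) ?(@flift_sub A (_ + _)).
- rewrite scaler_sumr -big_split; apply: eq_bigr => t _ /=.
  by rewrite coefD coefZ scalerDl scalerA.
- by apply/fsubsetP => t tf; rewrite !inE tf ?orbT.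
- by apply/fsubsetP => t tf; rewrite !inE tf ?orbT.
- by apply/fsubsetP => t tf; rewrite !inE tf ?orbT.
Qed.

HB.instance Definition _ := GRing.isLinear.Build K F V _ (flift phi) flift_linear.

Lemma flift_single t : flift phi (single t) = phi t.
Proof.
rewrite (@flift_sub [fset t]); last first.
  by apply/fsubsetP => x; rewrite mem_supp coef_single inE; case: (x == t); rewrite ?eqxx.
by rewrite big_seq_fset1 coef_single eqxx scale1r.
Qed.

End Lift.

Lemma freemodE f : f = flift single f.
Proof.
apply/freemodP => t; rewrite fliftE raddf_sum /=.
under eq_bigr => i do rewrite coefZ coef_single mulr_natr mulrb (eq_sym t).
rewrite -big_mkcond /=; case: (boolP (t \in supp f)) => tf.
  by rewrite -big_filter filter_pred1_uniq ?fset_uniq ?big_seq1.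
by rewrite coef_out// big_seq_cond big1// => i /andP[+ /eqP ti]; rewrite ti (negPf tf).
Qed.

Lemma freemod_ind (P : F -> Prop) :
  P 0 -> (forall k t f, P f -> P (k *: single t + f)) -> forall f, P f.
Proof.
move=> P0 PD f; rewrite (freemodE f) fliftE.
elim: (enum_fset (supp f)) => [|t s IH]; first by rewrite big_nil.
by rewrite big_cons; apply: PD.
Qed.

Lemma linear_ext (V : lmodType K) (h1 h2 : {linear F -> V}) :
  (forall t, h1 (single t) = h2 (single t)) -> h1 =1 h2.
Proof.
move=> e; elim/freemod_ind => [|k t f IH]; first by rewrite !raddf0.
by rewrite !linearP e IH.
Qed.

Lemma flift_ext (V : lmodType K) (phi psi : T -> V) : phi =1 psi ->
  flift phi =1 flift psi.
Proof. by move=> e f; rewrite !fliftE; apply: eq_bigr => t _; rewrite e. Qed.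

End FreeMod.

Arguments single {K T} t.

Section SemigroupAlgebra.
Context (K : comPzRingType) (M : monoidType).

Definition semigroup_algebra : Type := freemod K M.
Local Notation A := semigroup_algebra.

HB.instance Definition _ := GRing.Lmodule.on A.

Definition samul : A -> A -> A := locked_with lock_key (fun f g =>
  flift (fun x => flift (fun y => single (x * y)%g) g) f).

Lemma samulE f g :
  samul f g = flift (fun x => flift (fun y => single (x * y)%g) g) f.
Proof. by rewrite /samul unlock. Qed.

Lemma flift_linear_fun (T : choiceType) (V : lmodType K) (phi psi : T -> V)
    (k : K) (f : freemod K T) :
  flift (fun x => k *: phi x + psi x) f = k *: flift phi f + flift psi f.
Proof.
rewrite !fliftE scaler_sumr -big_split; apply: eq_bigr => t _ /=.
by rewrite scalerDr !scalerA [k * _]mulrC.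
Qed.

Lemma samul_linl k (f1 f2 g : A) :
  samul (k *: f1 + f2) g = k *: samul f1 g + samul f2 g.
Proof. by rewrite !samulE linearP. Qed.

Lemma samul_linr k (f g1 g2 : A) :
  samul f (k *: g1 + g2) = k *: samul f g1 + samul f g2.
Proof.
rewrite !samulE -flift_linear_fun; apply: flift_ext => x; exact: linearP.
Qed.

Lemma samul0l (g : A) : samul 0 g = 0.
Proof. by rewrite samulE raddf0. Qed.

Lemma samul0r (g : A) : samul g 0 = 0.
Proof.
have := samul_linr 1 g 0 0.
rewrite scale1r addr0 scale1r => /eqP.
by rewrite -subr_eq subrr eq_sym => /eqP.
Qed.

Lemma samul_single x y : samul (single x) (single y) = single (x * y)%g.
Proof. by rewrite samulE !flift_single. Qed.

Fact samulA : associative samul.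
Proof.
elim/freemod_ind=> [|k x f IH] g h; first by rewrite !samul0l.
rewrite !samul_linl IH; congr (_ *: _ + _).
elim/freemod_ind: g h => [|k' y g IHg] h; first by rewrite samul0r !samul0l samul0r.
rewrite samul_linr !samul_linl samul_linr IHg; congr (_ *: _ + _).
elim/freemod_ind: h => [|k'' z h IHh]; first by rewrite !samul0r.
by rewrite !samul_linr IHh !samul_single mulgA.
Qed.

Fact sa1mul : left_id (single 1%g) samul.
Proof.
elim/freemod_ind=> [|k x f IH]; first by rewrite samul0r.
by rewrite samul_linr IH samul_single mul1g.
Qed.

Fact samul1 : right_id (single 1%g) samul.
Proof.
elim/freemod_ind=> [|k x f IH]; first by rewrite samul0l.
by rewrite samul_linl IH samul_single mulg1.
Qed.

Fact samulDl : left_distributive samul +%R.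
Proof. by move=> f g h; rewrite -[f]scale1r samul_linl !scale1r. Qed.

Fact samulDr : right_distributive samul +%R.
Proof. by move=> f g h; rewrite -[g]scale1r samul_linr !scale1r. Qed.

HB.instance Definition _ :=
  GRing.Zmodule_isPzRing.Build A samulA sa1mul samul1 samulDl samulDr.

Definition sa_elt (x : M) : A := single x.

Lemma sa_ind (P : A -> Prop) :
  P 0 -> (forall k x f, P f -> P (k *: sa_elt x + f)) -> forall f, P f.
Proof. exact: freemod_ind. Qed.

Lemma sa_eltM x y : sa_elt (x * y)%g = sa_elt x * sa_elt y.
Proof. by rewrite [RHS]samul_single. Qed.

Lemma sa_elt1 : sa_elt 1%g = 1. Proof. by []. Qed.

Lemma sa_scalerAl k (f g : A) : k *: (f * g) = (k *: f) * g.
Proof. by have := samul_linl k f 0 g; rewrite samul0l !addr0. Qed.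

Lemma sa_scalerAr k (f g : A) : k *: (f * g) = f * (k *: g).
Proof. by have := samul_linr k f g 0; rewrite samul0r !addr0. Qed.

Lemma sa_linl k (f1 f2 g : A) : (k *: f1 + f2) * g = k *: (f1 * g) + f2 * g.
Proof. exact: samul_linl. Qed.

Lemma sa_linr k (f g1 g2 : A) : f * (k *: g1 + g2) = k *: (f * g1) + f * g2.
Proof. exact: samul_linr. Qed.

Fact mulr_linear (r : A) : linear (fun f : A => f * r).
Proof. by move=> k f g; rewrite mulrDl sa_scalerAl. Qed.

End SemigroupAlgebra.

Arguments sa_elt K {M} x.

Section Tensor.
Context (K : comPzRingType) (A B : lmodType K).
Local Notation F := (freemod K (A * B)%type).

Inductive bilinear_relations : set F :=
| BilinearLeft k a a' b : bilinear_relations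
    (single (k *: a + a', b) - (k *: single (a, b) + single (a', b)))
| BilinearRight k a b b' : bilinear_relations
    (single (a, k *: b + b') - (k *: single (a, b) + single (a, b'))).

Definition tensor : Type := quotmod bilinear_relations.

HB.instance Definition _ := GRing.Lmodule.on tensor.

Definition tens (a : A) (b : B) : tensor := qpi bilinear_relations (single (a, b)).

Lemma tens_linl k a a' b : tens (k *: a + a') b = k *: tens a b + tens a' b.
Proof.
by have /qpiP := sub_span (BilinearLeft k a a' b); rewrite linearP.
Qed.

Lemma tens_linr k a b b' : tens a (k *: b + b') = k *: tens a b + tens a b'.
Proof.
by have /qpiP := sub_span (BilinearRight k a b b'); rewrite linearP.
Qed.

Lemma tensor_ind (P : tensor -> Prop) :
  P 0 -> (forall k a b t, P t -> P (k *: tens a b + t)) -> forall t, P t.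
Proof.
move=> P0 PD; elim/qpi_ind; elim/freemod_ind=> [|k [a b] f IH].
  by rewrite raddf0.
by rewrite linearP; apply: PD.
Qed.

End Tensor.

Section TensorMap.
Context (K : comPzRingType) (A B : lmodType K).

Definition tens_map (h : B -> B) : tensor A B -> tensor A B :=
  qlift (flift (fun p : A * B => tens p.1 (h p.2))).

Context (h : {linear B -> B}).

Lemma tens_map_pi f :
  tens_map h (qpi _ f) = flift (fun p : A * B => tens p.1 (h p.2)) f.
Proof.
apply: qliftE => _ [k a a' b|k a b b']; rewrite raddfB /= linearP /= !flift_single /=.
  by rewrite tens_linl subrr.
by rewrite linearP tens_linr subrr.
Qed.

Lemma tens_mapE a b : tens_map h (tens a b) = tens a (h b).
Proof. by rewrite [LHS]tens_map_pi flift_single. Qed.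

Fact tens_map_linear : linear (tens_map h).
Proof.
move=> k; elim/qpi_ind=> u; elim/qpi_ind=> v.
by rewrite -linearP !tens_map_pi linearP.
Qed.

HB.instance Definition _ := GRing.isLinear.Build K (tensor A B) (tensor A B) _
  (tens_map h) tens_map_linear.

End TensorMap.

Section ExelMonoid.
Context (G : groupType).
Local Open Scope group_scope.

(* The word [:: t_1; ...; t_n] stands for [t_1]...[t_n]. *)
Inductive exel_rel : seq G -> seq G -> Prop :=
| ExelUnit : exel_rel [:: 1] [::]
| ExelLeft s t : exel_rel [:: s^-1; s; t] [:: s^-1; s * t]
| ExelRight s t : exel_rel [:: s; t; t^-1] [:: s * t; t^-1]
| ExelCat u u' v v' :
    exel_rel u u' -> exel_rel v v' -> exel_rel (u ++ v) (u' ++ v')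
| ExelRefl u : exel_rel u u
| ExelSym u v : exel_rel u v -> exel_rel v u
| ExelTrans u v w : exel_rel u v -> exel_rel v w -> exel_rel u w.

Definition exel_relb : rel (seq G) := fun u v => `[< exel_rel u v >].

Fact exel_relb_refl : reflexive exel_relb.
Proof. by move=> u; apply/asboolP/ExelRefl. Qed.

Fact exel_relb_sym : symmetric exel_relb.
Proof. by move=> u v; apply/asboolP/asboolP; apply: ExelSym. Qed.

Fact exel_relb_trans : transitive exel_relb.
Proof.
by move=> v u w /asboolP uv /asboolP vw; apply/asboolP; apply: ExelTrans uv vw.
Qed.

Canonical exel_equiv :=
  EquivRel exel_relb exel_relb_refl exel_relb_sym exel_relb_trans.

Definition exel_monoid : Type := {eq_quot exel_equiv}%qT.
Local Notation S := exel_monoid.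

HB.instance Definition _ := Choice.on S.
HB.instance Definition _ := EqQuotient.on S.

Definition exel_pi : seq G -> S := locked_with lock_key (fun u => \pi_S%qT u).

Lemma exel_piE u : exel_pi u = \pi_S%qT u.
Proof. by rewrite /exel_pi unlock. Qed.

Lemma exel_piP u v : exel_pi u = exel_pi v <-> exel_rel u v.
Proof.
split=> [/eqP|h]; first by rewrite !exel_piE eqmodE => /asboolP.
by apply/eqP; rewrite !exel_piE eqmodE; apply/asboolP.
Qed.

Lemma exel_reprK (x : S) : exel_pi (repr x) = x.
Proof. by rewrite exel_piE reprK. Qed.

Lemma exel_pi_ind (P : S -> Prop) : (forall u, P (exel_pi u)) -> forall x, P x.
Proof. by move=> h x; rewrite -(exel_reprK x). Qed.

Lemma exel_repr_pi u : exel_rel (repr (exel_pi u)) u.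
Proof. by apply/exel_piP; rewrite exel_reprK. Qed.

Definition word_star (u : seq G) : seq G := rev [seq g^-1 | g <- u].

Lemma word_starM u v : word_star (u ++ v) = word_star v ++ word_star u.
Proof. by rewrite /word_star map_cat rev_cat. Qed.

Lemma word_starK u : word_star (word_star u) = u.
Proof.
rewrite /word_star map_rev revK -map_comp -[RHS]map_id.
by apply: eq_map => g /=; rewrite invgK.
Qed.

Lemma exel_rel_star u v : exel_rel u v -> exel_rel (word_star u) (word_star v).
Proof.
elim=> {u v}.
- by rewrite /word_star /= /rev /= invg1; apply: ExelUnit.
- move=> s t; rewrite /word_star /rev /= invgK invgM.
  by have := ExelRight t^-1 s^-1; rewrite invgK.
- move=> s t; rewrite /word_star /rev /= invgK invgM.
  by have := ExelLeft t^-1 s^-1; rewrite invgK.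
- by move=> u u' v v' _ Hu _ Hv; rewrite !word_starM; apply: ExelCat.
- by move=> u; apply: ExelRefl.
- by move=> u v _; apply: ExelSym.
- by move=> u v w _ uv _; apply: ExelTrans.
Qed.

Definition exel_mul : S -> S -> S := locked_with lock_key (fun x y =>
  exel_pi (repr x ++ repr y)).
(* Sends [t_1]...[t_n] to [t_n^-1]...[t_1^-1]. *)
Definition exel_inv : S -> S := locked_with lock_key (fun x =>
  exel_pi (word_star (repr x))).

Lemma exel_mulE u v : exel_mul (exel_pi u) (exel_pi v) = exel_pi (u ++ v).
Proof.
rewrite /exel_mul unlock.
by apply/exel_piP/ExelCat; apply: exel_repr_pi.
Qed.

Lemma exel_invE u : exel_inv (exel_pi u) = exel_pi (word_star u).
Proof.
rewrite /exel_inv unlock.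
exact/exel_piP/exel_rel_star/exel_repr_pi.
Qed.

Fact exel_mulA : associative exel_mul.
Proof.
elim/exel_pi_ind=> u; elim/exel_pi_ind=> v; elim/exel_pi_ind=> w.
by rewrite !exel_mulE catA.
Qed.

Fact exel_mul1 : left_id (exel_pi [::]) exel_mul.
Proof. by elim/exel_pi_ind=> u; rewrite exel_mulE. Qed.

Fact exel_invK : involutive exel_inv.
Proof. by elim/exel_pi_ind=> u; rewrite !exel_invE word_starK. Qed.

Fact exel_invM : {morph exel_inv : x y / exel_mul x y >-> exel_mul y x}.
Proof.
elim/exel_pi_ind=> u; elim/exel_pi_ind=> v.
by rewrite exel_mulE !exel_invE exel_mulE word_starM.
Qed.

HB.instance Definition _ :=
  isStarMonoid.Build S exel_mulA exel_mul1 exel_invK exel_invM.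

Definition exel_gen (g : G) : S := exel_pi [:: g].
Local Notation "[ g ]" := (exel_gen g).

Definition exel_e (g : G) : S := [g] * [g^-1].
Local Notation e := exel_e.

Definition exel_idem (x : S) : Prop := x * x = x.

Lemma exel_piM u v : exel_pi (u ++ v) = exel_pi u * exel_pi v.
Proof. exact/esym/exel_mulE. Qed.

Lemma exel_ind (P : S -> Prop) :
  P 1 -> (forall g x, P x -> P ([g] * x)) -> forall x, P x.
Proof.
move=> P1 PM; elim/exel_pi_ind; elim=> [//|g u IH].
by rewrite -cat1s exel_piM; apply: PM.
Qed.

Lemma exel_gen1 : [1] = 1.
Proof. exact/exel_piP/ExelUnit. Qed.

Lemma exel_genV g : [g]^-1 = [g^-1].
Proof. by rewrite [LHS]exel_invE. Qed.

Lemma exel_left s t : [s^-1] * [s] * [t] = [s^-1] * [s * t].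
Proof. by rewrite /exel_gen -!exel_piM; apply/exel_piP; apply: ExelLeft. Qed.

Lemma exel_right s t : [s] * [t] * [t^-1] = [s * t] * [t^-1].
Proof. by rewrite /exel_gen -!exel_piM; apply/exel_piP; apply: ExelRight. Qed.

Lemma exel_left' s t : [s] * [s^-1] * [t] = [s] * [s^-1 * t].
Proof. by have := exel_left s^-1 t; rewrite invgK. Qed.

Lemma exel_genK g : [g] * [g^-1] * [g] = [g].
Proof. by rewrite exel_left' mulVg exel_gen1 mulg1. Qed.

Lemma exel_genM g h : [g] * [h] = e g * [g * h].
Proof. by rewrite /e exel_left' mulKg. Qed.

Lemma exel_gen_e g a : [g] * e a = e (g * a) * [g].
Proof.
rewrite /e mulgA exel_right -{1}(exel_genK (g * a)) -!mulgA; congr (_ * _).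
by rewrite mulgA exel_left mulgK.
Qed.

Lemma exel_e_idem a : e a * e a = e a.
Proof. by rewrite /e mulgA exel_genK. Qed.

Lemma exel_eC a b : e a * e b = e b * e a.
Proof.
rewrite {1}/e -mulgA exel_gen_e mulgA exel_gen_e mulVKg.
by rewrite -mulgA.
Qed.

Definition exel_eprod (s : seq G) : S := foldr (fun a x => e a * x) 1 s.

Lemma exel_eprod_cat s t : exel_eprod (s ++ t) = exel_eprod s * exel_eprod t.
Proof. by elim: s => [|a s IH] /=; rewrite ?mul1g // IH mulgA. Qed.

Lemma exel_e_eprodC a s : e a * exel_eprod s = exel_eprod s * e a.
Proof.
elim: s => [|b s IH] /=; first by rewrite mulg1 mul1g.
by rewrite mulgA exel_eC -(mulgA (e b)) IH mulgA.
Qed.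

Lemma exel_eprod_idem s : exel_idem (exel_eprod s).
Proof.
rewrite /exel_idem; elim: s => [|a s IH] /=; first by rewrite mulg1.
by rewrite {1}exel_e_eprodC -mulgA (mulgA (e a)) exel_e_idem exel_e_eprodC mulgA IH.
Qed.

Lemma exel_gen_eprod g s :
  [g] * exel_eprod s = exel_eprod [seq g * a | a <- s] * [g].
Proof.
elim: s => [|a s IH] /=; first by rewrite mulg1 mul1g.
by rewrite mulgA exel_gen_e -(mulgA (e _)) IH mulgA.
Qed.

Lemma exel_normal x : exists s h, x = exel_eprod s * [h].
Proof.
elim/exel_ind: x => [|g x [s [h ->]]].
  by exists [::], 1; rewrite exel_gen1 mul1g.
exists ([seq g * a | a <- s] ++ [:: g]), (g * h).
by rewrite mulgA exel_gen_eprod exel_eprod_cat /= mulg1 -mulgA exel_genM mulgA.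
Qed.

Definition word_deg (u : seq G) : G := foldr *%g 1 u.

Lemma word_degM u v : word_deg (u ++ v) = word_deg u * word_deg v.
Proof. by elim: u => [|g u IH] /=; rewrite ?mul1g // IH mulgA. Qed.

Lemma exel_rel_deg u v : exel_rel u v -> word_deg u = word_deg v.
Proof.
elim=> {u v} //=.
- by rewrite mulg1.
- by move=> s t; rewrite !mulg1.
- by move=> s t; rewrite !mulg1 !mulgA.
- by move=> u u' v v' _ Hu _ Hv; rewrite !word_degM Hu Hv.
- by move=> u v w _ -> _ ->.
Qed.

Definition exel_deg (x : S) : G := word_deg (repr x).

Lemma exel_degE u : exel_deg (exel_pi u) = word_deg u.
Proof. exact/exel_rel_deg/exel_repr_pi. Qed.

Lemma exel_degM x y : exel_deg (x * y) = exel_deg x * exel_deg y.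
Proof.
elim/exel_pi_ind: x => u; elim/exel_pi_ind: y => v.
by rewrite -exel_piM !exel_degE word_degM.
Qed.

Lemma exel_deg_gen g : exel_deg [g] = g.
Proof. by rewrite exel_degE /= mulg1. Qed.

Lemma exel_deg_eprod s : exel_deg (exel_eprod s) = 1.
Proof.
elim: s => [|a s IH] /=; first exact: exel_degE.
by rewrite !exel_degM IH !exel_deg_gen mulgV mulg1.
Qed.

Lemma exel_idemP x : exel_idem x <-> exists s, x = exel_eprod s.
Proof.
split=> [xx|[s ->]]; last exact: exel_eprod_idem.
have [s [h xE]] := exel_normal x; exists s.
suff h1 : h = 1 by rewrite xE h1 exel_gen1 mulg1.
have dx : exel_deg x = h by rewrite xE exel_degM exel_deg_eprod exel_deg_gen mul1g.
have := congr1 exel_deg xx; rewrite exel_degM dx => /(canRL (mulKg h)).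
by rewrite mulVg.
Qed.

Lemma exel_idem_conj x u : exel_idem u -> exel_idem (x^-1 * u * x).
Proof.
elim/exel_ind: x u => [|g x IH] u ui.
  by rewrite invg1 mul1g mulg1.
have -> : ([g] * x)^-1 * u * ([g] * x) = x^-1 * ([g^-1] * u * [g]) * x.
  by rewrite invgM exel_genV !mulgA.
apply: IH.
move/exel_idemP: ui => [s ->]; apply/exel_idemP.
exists ([seq g^-1 * a | a <- s] ++ [:: g^-1]).
by rewrite exel_eprod_cat exel_gen_eprod /= mulg1 -mulgA /e invgK.
Qed.

End ExelMonoid.

Notation par_algebra K G :=
  (semigroup_algebra K (exel_monoid G)) (only parsing).
Notation group_algebra K G := (semigroup_algebra K G) (only parsing).

Section IdemModule.
Context (K : comPzRingType) (G : groupType).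
Local Notation A := (par_algebra K G).

Definition idem_pred : {pred A} :=
  fun u => `[< forall x, x \in supp u -> exel_idem x >].

Lemma idem_predP (u : A) :
  u \in idem_pred <-> forall x, x \in supp u -> exel_idem x.
Proof. by split=> [/asboolP|h] //; apply/asboolP. Qed.

Fact idem_predZD k (u v : A) :
  u \in idem_pred -> v \in idem_pred -> k *: u + v \in idem_pred.
Proof.
move=> /idem_predP iu /idem_predP iv; apply/idem_predP => x.
rewrite mem_supp coefD coefZ; case: (boolP (x \in supp u)) => [/iu//|].
case: (boolP (x \in supp v)) => [/iv//|].
by rewrite !mem_supp !negbK => /eqP-> /eqP->; rewrite mulr0 addr0 eqxx.
Qed.

Fact idem_pred0 : 0 \in idem_pred.
Proof. by apply/idem_predP => x; rewrite mem_supp raddf0 eqxx. Qed.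

Fact idem_pred_zmod : zmod_closed idem_pred.
Proof.
split=> [|u v iu iv]; first exact: idem_pred0.
by rewrite addrC -scaleN1r; apply: idem_predZD.
Qed.

HB.instance Definition _ :=
  GRing.isZmodClosed.Build A idem_pred idem_pred_zmod.

Record idem_algebra : predArgType :=
  IdemAlgebra { idem_val : A; idem_valP : idem_val \in idem_pred }.
Local Notation B := idem_algebra.

HB.instance Definition _ := [isSub for idem_val].
HB.instance Definition _ := [Choice of B by <:].
HB.instance Definition _ := [SubChoice_isSubZmodule of B by <:].

Lemma idem_valD u v : idem_val (u + v) = idem_val u + idem_val v.
Proof. exact: (raddfD (val : B -> A)). Qed.

(* Determined by u <| [g] = [g^-1] u [g], see conj_act_gen and conj_actM. *)
Definition conj_act (u r : A) : A :=
  flift (fun x => sa_elt K (x^-1)%g * u * sa_elt K x) r.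

Lemma conj_act_elt u x :
  conj_act u (sa_elt K x) = sa_elt K (x^-1)%g * u * sa_elt K x.
Proof. exact: flift_single. Qed.

Lemma conj_act_gen u (g : G) :
  conj_act u (sa_elt K (exel_gen g)) =
  sa_elt K (exel_gen g^-1%g) * u * sa_elt K (exel_gen g).
Proof. by rewrite conj_act_elt exel_genV. Qed.

Lemma conj_act_linr k u r1 r2 :
  conj_act u (k *: r1 + r2) = k *: conj_act u r1 + conj_act u r2.
Proof. exact: linearP. Qed.

Lemma conj_act_linl k u v r :
  conj_act (k *: u + v) r = k *: conj_act u r + conj_act v r.
Proof.
rewrite -flift_linear_fun; apply: flift_ext => x.
by rewrite sa_linr sa_linl.
Qed.

Lemma conj_act0l r : conj_act 0 r = 0.
Proof. by have := conj_act_linl (-1) 0 0 r; rewrite scaler0 addr0 scaleN1r addNr. Qed.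

Lemma conj_act0r u : conj_act u 0 = 0.
Proof. exact: raddf0. Qed.

Lemma conj_act1 u : conj_act u 1 = u.
Proof. by rewrite -sa_elt1 conj_act_elt invg1 sa_elt1 mul1r mulr1. Qed.

Lemma conj_actM u r1 r2 : conj_act u (r1 * r2) = conj_act (conj_act u r1) r2.
Proof.
elim/sa_ind: r1 r2 => [|k x r1 IH] r2; first by rewrite mul0r conj_act0r conj_act0l.
have -> := sa_linl k (sa_elt K x) r1 r2.
have -> := conj_act_linr k u (sa_elt K x * r2) (r1 * r2).
have -> := conj_act_linr k u (sa_elt K x) r1.
have -> := conj_act_linl k (conj_act u (sa_elt K x)) (conj_act u r1) r2.
have -> := IH r2; congr (_ *: _ + _).
elim/sa_ind: r2 => [|k' y r2 IH2]; first by rewrite mulr0 !conj_act0r.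
have -> := sa_linr k' (sa_elt K x) (sa_elt K y) r2.
have -> := conj_act_linr k' u (sa_elt K x * sa_elt K y) (sa_elt K x * r2).
have -> := conj_act_linr k' (conj_act u (sa_elt K x)) (sa_elt K y) r2.
have -> := IH2; congr (_ *: _ + _).
rewrite -sa_eltM !conj_act_elt invgM !sa_eltM.
by rewrite !mulrA.
Qed.

Lemma conj_act_idem u r : u \in idem_pred -> conj_act u r \in idem_pred.
Proof.
move=> /idem_predP iu.
elim/sa_ind: r => [|k x r IH]; first by rewrite conj_act0r idem_pred0.
rewrite conj_act_linr; apply: idem_predZD => //.
rewrite conj_act_elt (freemodE u) fliftE.
rewrite mulr_sumr mulr_suml big_seq; apply: rpred_sum => y yu.
rewrite -sa_scalerAr -sa_scalerAl -[single y]/(sa_elt K y) -!sa_eltM.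
rewrite -[_ *: _]addr0; apply: idem_predZD; last exact: idem_pred0.
apply/idem_predP => z; rewrite mem_supp coef_single.
by case: (eqVneq z) => [->|]; rewrite ?eqxx// => _; apply/exel_idem_conj/iu.
Qed.

Definition idem_scale (r : A^c) (u : B) : B :=
  IdemAlgebra (conj_act_idem r (idem_valP u)).

Fact idem_scaleA a b u : idem_scale a (idem_scale b u) = idem_scale (a * b) u.
Proof. by apply: val_inj; rewrite /= conj_actM. Qed.

Fact idem_scale1 : left_id 1 idem_scale.
Proof. by move=> u; apply: val_inj; rewrite /= conj_act1. Qed.

Fact idem_scaleDr : right_distributive idem_scale +%R.
Proof.
move=> r u v; apply: val_inj; apply: etrans (esym (idem_valD _ _)).
rewrite -[LHS]/(conj_act (idem_val (u + v)) r) idem_valD.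
by have := conj_act_linl 1 (idem_val u) (idem_val v) r; rewrite !scale1r.
Qed.

Fact idem_scaleDl u : {morph idem_scale^~ u : a b / a + b}.
Proof.
move=> a b; apply: val_inj; apply: etrans (esym (idem_valD _ _)).
by have := conj_act_linr 1 (idem_val u) a b; rewrite !scale1r.
Qed.

HB.instance Definition _ := GRing.Zmodule_isLmodule.Build A^c B
  idem_scaleA idem_scale1 idem_scaleDr idem_scaleDl.

End IdemModule.

Definition trivial_module (K : comPzRingType) (G : groupType) : Type := K.

Section TrivialModule.
Context (K : comPzRingType) (G : groupType).
Local Notation A := (group_algebra K G).
Local Notation trivial_module := (trivial_module K G).

HB.instance Definition _ := GRing.Zmodule.on trivial_module.

Definition augmentation (a : A) : K := \sum_(g <- supp a) coef g a.

Lemma augmentationE a : augmentation a = flift (fun _ => 1 : K^o) a.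
Proof. by rewrite fliftE; apply: eq_bigr => g _; rewrite [RHS]mulr1. Qed.

Lemma augmentation_lin k a b :
  augmentation (k *: a + b) = k * augmentation a + augmentation b.
Proof. by rewrite !augmentationE linearP. Qed.

Lemma augmentation0 : augmentation 0 = 0.
Proof. by rewrite augmentationE raddf0. Qed.

Lemma augmentation_elt g : augmentation (sa_elt K g) = 1.
Proof. by rewrite augmentationE flift_single. Qed.

Lemma augmentationM a b : augmentation (a * b) = augmentation a * augmentation b.
Proof.
elim/sa_ind: a b => [|k x a IH] b; first by rewrite mul0r augmentation0 mul0r.
rewrite sa_linl !augmentation_lin IH mulrDl; congr (_ + _).
rewrite -mulrA; congr (_ * _).
elim/sa_ind: b => [|k' y b IHb]; first by rewrite mulr0 augmentation0 mulr0.
rewrite sa_linr !augmentation_lin IHb mulrDr; congr (_ + _).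
by rewrite -sa_eltM !augmentation_elt mulr1 mul1r.
Qed.

Definition trivial_scale (a : A^c) (k : trivial_module) : trivial_module :=
  (k : K) * augmentation a.

Fact trivial_scaleA a b k :
  trivial_scale a (trivial_scale b k) = trivial_scale (a * b) k.
Proof. by rewrite /trivial_scale [a * b]/(_ * _ : A) augmentationM mulrA. Qed.

Fact trivial_scale1 : left_id 1 trivial_scale.
Proof. by move=> k; rewrite /trivial_scale augmentation_elt mulr1. Qed.

Fact trivial_scaleDr : right_distributive trivial_scale +%R.
Proof. by move=> a k l; apply: mulrDl. Qed.

Fact trivial_scaleDl k : {morph trivial_scale^~ k : a b / a + b}.
Proof.
move=> a b; rewrite /trivial_scale.
by have := augmentation_lin 1 a b; rewrite scale1r mul1r => ->; rewrite mulrDr.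
Qed.

HB.instance Definition _ := GRing.Zmodule_isLmodule.Build A^c trivial_module
  trivial_scaleA trivial_scale1 trivial_scaleDr trivial_scaleDl.

End TrivialModule.

Section GlobalTensor.
Context (K : comPzRingType) (G : groupType).
Local Notation KG := (group_algebra K G).
Local Notation A := (par_algebra K G).
Local Notation T := (tensor KG A).
Local Notation "[ g ]" := (sa_elt K (exel_gen g)).
Local Notation e g := (sa_elt K (exel_e g)).

Inductive par_tensor_relations : set T :=
| ParTensorRel (g h : G) (z : A) : par_tensor_relations
    (tens (sa_elt K (g * h)%g) (e h^-1%g * z) -
     tens (sa_elt K g) ([h] * z)).

Definition par_tensor : Type := quotmod par_tensor_relations.
Local Notation Q := par_tensor.

HB.instance Definition _ := GRing.Zmodule.on par_tensor.

Definition mulr_map (r : A) : A -> A := fun z => z * r.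

HB.instance Definition _ r :=
  GRing.isLinear.Build K A A _ (mulr_map r) (mulr_linear r).

Definition tens_act (r : A) : T -> T := tens_map (mulr_map r).

Fact tens_act_linear r : linear (tens_act r).
Proof. exact: (tens_map_linear (mulr_map r)). Qed.

HB.instance Definition _ r :=
  GRing.isLinear.Build K T T _ (tens_act r) (tens_act_linear r).

Lemma tens_actE r a z : tens_act r (tens a z) = tens a (z * r).
Proof. exact: (tens_mapE (mulr_map r)). Qed.

Lemma tens_act0 r : tens_act r 0 = 0. Proof. exact: raddf0. Qed.

Lemma tens_act_lin r k s t :
  tens_act r (k *: s + t) = k *: tens_act r s + tens_act r t.
Proof. exact: linearP. Qed.

Lemma tens_actB r s t : tens_act r (s - t) = tens_act r s - tens_act r t.
Proof. exact: raddfB. Qed.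

Lemma tens_actM r s t : tens_act s (tens_act r t) = tens_act (r * s) t.
Proof.
elim/tensor_ind: t => [|k a z t IH]; first by rewrite !tens_act0.
by rewrite !tens_act_lin IH !tens_actE mulrA.
Qed.

Lemma tens_act1 t : tens_act 1 t = t.
Proof.
elim/tensor_ind: t => [|k a z t IH]; first by rewrite tens_act0.
by rewrite tens_act_lin IH tens_actE mulr1.
Qed.

Lemma tens_actD r s t : tens_act (r + s) t = tens_act r t + tens_act s t.
Proof.
elim/tensor_ind: t => [|k a z t IH]; first by rewrite !tens_act0 addr0.
rewrite !tens_act_lin IH !tens_actE mulrDr.
have := tens_linr 1 a (z * r) (z * s); rewrite !scale1r => ->.
by rewrite scalerDr addrACA.
Qed.

Definition pi_act (r : A) : T -> quotmod par_tensor_relations :=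
  fun t => qpi par_tensor_relations (tens_act r t).

Fact pi_act_linear r : linear (pi_act r).
Proof. by move=> k s t; rewrite /pi_act !linearP. Qed.

HB.instance Definition _ r :=
  GRing.isLinear.Build K T _ _ (pi_act r) (pi_act_linear r).

(* Induced by (a (x) z) r = a (x) (z r). *)
Definition par_tensor_scale (r : A^c) : Q -> Q := qlift (pi_act r).

Lemma par_tensor_scaleE (r : A) t :
  par_tensor_scale r (qpi _ t) = qpi _ (tens_act r t).
Proof.
apply: (qliftE (h := pi_act r)) => _ [g h z]; apply/qpi0.
rewrite tens_actB !tens_actE -!mulrA; apply: sub_span; exact: ParTensorRel.
Qed.

Fact par_tensor_scaleA a b x :
  par_tensor_scale a (par_tensor_scale b x) = par_tensor_scale (a * b) x.
Proof. by elim/qpi_ind: x => t; rewrite !par_tensor_scaleE tens_actM. Qed.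

Fact par_tensor_scale1 : left_id 1 par_tensor_scale.
Proof. by elim/qpi_ind=> t; rewrite par_tensor_scaleE tens_act1. Qed.

Fact par_tensor_scaleDr : right_distributive par_tensor_scale +%R.
Proof.
move=> r; elim/qpi_ind=> s; elim/qpi_ind=> t.
by rewrite -[_ + _]raddfD !par_tensor_scaleE raddfD [LHS]raddfD.
Qed.

Fact par_tensor_scaleDl x : {morph par_tensor_scale^~ x : a b / a + b}.
Proof.
move=> a b; elim/qpi_ind: x => t.
by rewrite !par_tensor_scaleE tens_actD [LHS]raddfD.
Qed.

HB.instance Definition _ := GRing.Zmodule_isLmodule.Build A^c par_tensor
  par_tensor_scaleA par_tensor_scale1 par_tensor_scaleDr par_tensor_scaleDl.

End GlobalTensor.

Definition par_cd (K : comPzRingType) (G : groupType) : \bar int :=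
  projdim (idem_algebra K G : rmodType (par_algebra K G)).

Definition cd (K : comPzRingType) (G : groupType) : \bar int :=
  projdim (trivial_module K G : rmodType (group_algebra K G)).

Definition pd_par_tensor (K : comPzRingType) (G : groupType) : \bar int :=
  projdim (par_tensor K G : rmodType (par_algebra K G)).

(* Main.v *)
Require Import Defs.
From HB Require Import structures.
From mathcomp Require Import all_boot all_order all_algebra.
From mathcomp Require Import finmap.
From mathcomp Require Import boolp classical_sets cardinality constructive_ereal.

(** Write A for the partial group algebra, B for the algebra of idempotents and
L for the globalization KG (x) A over G_par.  Two exact functors compare right
KG-modules with right A-modules.

The first one sends a KG-module X to X (x) B with the diagonal action; up to
isomorphism it is the functor X |-> X (x)_KG L.  It is exact because B is free
over K, it sends K to B, and it sends a projective KG-module to a direct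
summand of a direct sum of copies of L (diag_projective_retract).  Applied to
a projective resolution of K of length n, it resolves B by n + 1 modules whose
projective dimension is at most that of L, whence pd B <= n + pd L
(pdle_idem_algebra).

If G is countable then L is projective (par_tensor_projective).  Indeed L is
generated by the elements x_g = g (x) 1 with the relations
x_g e_(g^-1 h) = x_h [h^-1 g].  To lift a map out of L along a surjection, lift
the x_g one after the other: a new lift has to satisfy finitely many
conditions, each one on the part cut out by an idempotent, and these conditions
agree on overlaps, so any lift can be corrected to satisfy all of them.

The second functor is the localization M |-> M (x)_A KG, which divides M by the
elements killed by some product of idempotents e_g.  It is exact, it preserves
projectivity and it sends B to K, whence cd_K(G) <= pd B (pdle_trivial).

Projective dimension is handled by syzygies.  In place of Ext or of Schanuel's
lemma, the relation stable_retract says that the identity of a module factors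
through another one modulo maps that factor through a projective; it passes to
syzygies, so bounds on the projective dimension descend along it. *)

Set Implicit Arguments.
Unset Strict Implicit.
Unset Printing Implicit Defensive.

Import GRing.Theory.

Local Open Scope ring_scope.

(** * Projective dimension by iterated syzygies *)

Section LinearPack.
Context (R : pzRingType) (U V : lmodType R).

Definition lin_of (f : U -> V) (f_lin : linear f) : {linear U -> V} :=
  HB.pack f (GRing.isLinear.Build R U V _ f f_lin).

Lemma lin_ofE (f : U -> V) (f_lin : linear f) x : lin_of f_lin x = f x.
Proof. by []. Qed.

End LinearPack.

Section Kernel.
Context (R : pzRingType) (U V : lmodType R) (f : {linear U -> V}).

Definition ker_pred : {pred U} := fun u => f u == 0.

Fact ker_pred_submod : submod_closed ker_pred.
Proof.
split=> [|k u v]; rewrite !unfold_in /= ?raddf0 ?eqxx// => /eqP fu /eqP fv.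
by rewrite linearP fu fv scaler0 addr0.
Qed.

HB.instance Definition _ :=
  GRing.isSubmodClosed.Build R U ker_pred ker_pred_submod.

Record kermod : predArgType := KerMod { ker_val : U; ker_valP : ker_val \in ker_pred }.

HB.instance Definition _ := [isSub for ker_val].
HB.instance Definition _ := [Choice of kermod by <:].
HB.instance Definition _ := [SubChoice_isSubLmodule of kermod by <:].

Definition ker_incl : {linear kermod -> U} := val.

Lemma ker_inclE x : f x = 0 <-> exists y, ker_incl y = x.
Proof.
split=> [/eqP fx|[y <-]]; last exact/eqP/(ker_valP y).
by exists (KerMod fx).
Qed.

Lemma ker_incl_inj : injective ker_incl. Proof. exact: val_inj. Qed.

End Kernel.

Section ProjectiveDimension.
Context (R : pzRingType).
Implicit Types (M N P Q : lmodType R).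

Definition surj (U V : Type) (f : U -> V) := forall b, exists a, f a = b.

Definition short_exact (U V W : zmodType) (i : U -> V) (p : V -> W) :=
  [/\ injective i, forall x, p x = 0 <-> exists y, i y = x & surj p].

Lemma kernel_exact (U V : lmodType R) (f : {linear U -> V}) :
  surj f -> short_exact (ker_incl f) f.
Proof. by split=> //; [exact: ker_incl_inj|exact: ker_inclE]. Qed.

(** Maps into a syzygy are obtained this way: define them into the ambient
projective module and check that the values are relations. *)
Lemma factor_mono (U V N : lmodType R) (i : {linear N -> V}) (f : {linear U -> V}) :
  injective i -> (forall u, exists y, i y = f u) ->
  exists g : {linear U -> N}, forall u, i (g u) = f u.
Proof.
move=> i_inj /choice[g gE].
have g_lin : linear g by move=> k u v; apply: i_inj; rewrite linearP !gE linearP.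
by exists (lin_of g_lin).
Qed.

Lemma freemod_projective (T : choiceType) : projective_module (freemod R T).
Proof.
move=> U V p f p_surj.
have /choice[phi phiE] : forall t, exists a, p a = f (single t) by move=> t; apply: p_surj.
exists (flift phi) => x.
apply: (linear_ext (h1 := p \o flift phi)) x => t /=.
by rewrite flift_single phiE.
Qed.

Definition free_cover M : {linear freemod R M -> M} := flift id.

Lemma free_cover_surj M : surj (free_cover M).
Proof. by move=> m; exists (single m); rewrite /free_cover /= flift_single. Qed.

Lemma projective_pair P Q :
  projective_module P -> projective_module Q -> projective_module (P * Q)%type.
Proof.
move=> Pp Qp U V p f p_surj.
have f1_lin : linear (fun x : P => f (x, 0)).
  by move=> k x y; rewrite -linearP /=; congr (f (_, _)); rewrite /= scaler0 addr0.
have f2_lin : linear (fun x : Q => f (0, x)).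
  by move=> k x y; rewrite -linearP /=; congr (f (_, _)); rewrite /= scaler0 addr0.
have [g1 g1E] := Pp _ _ p (lin_of f1_lin) p_surj.
have [g2 g2E] := Qp _ _ p (lin_of f2_lin) p_surj.
have g_lin : linear (fun x : P * Q => g1 x.1 + g2 x.2).
  by move=> k [x1 x2] [y1 y2] /=; rewrite !linearP scalerDr addrACA.
exists (lin_of g_lin) => -[x1 x2] /=.
rewrite raddfD /= g1E g2E !lin_ofE -raddfD /=; congr (f (_, _)).
  by rewrite /= addr0.
by rewrite /= add0r.
Qed.

(** Ordinary retracts do not pass to syzygies, since the lifted composite is the
identity only up to a map through a projective; allowing such an error from the
start gives a relation that does pass.  It contains both direct summands and,
with M = N, the comparison of two choices of a syzygy. *)
Definition stable_retract M N := exists Q (a : {linear M -> N}) (b : {linear N -> M})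
    (u : {linear M -> Q}) (v : {linear Q -> M}),
  projective_module Q /\ forall x, x = b (a x) + v (u x).

Lemma retract_stable M N (a : {linear M -> N}) (b : {linear N -> M}) :
  cancel a b -> stable_retract M N.
Proof.
move=> abK; exists (freemod R void), a, b, \0, \0.
by split=> [|x]; [exact: freemod_projective|rewrite abK addr0].
Qed.

Lemma stable_retract_projective M N :
  stable_retract M N -> projective_module N -> projective_module M.
Proof.
move=> [Q [a [b [u [v [Qp MN]]]]]] Np U V p f p_surj.
have [g gE] := Np _ _ p (f \o b) p_surj.
have [h hE] := Qp _ _ p (f \o v) p_surj.
exists ((g \o a) \+ (h \o u)) => x.
by rewrite /= raddfD /= gE hE /= -raddfD -MN.
Qed.

(** Lift a, b and v to maps A, B and w between the projectives.  Then
id - B A - w u p takes its values in N, so it is a map t : P -> N.  As p kills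
N, restricting to N shows that the identity of N is the composite induced by A
and B plus t restricted to N, which factors through the projective P. *)
Lemma stable_retract_syzygy M M' N N' P P' (i : {linear N -> P}) (p : {linear P -> M})
    (i' : {linear N' -> P'}) (p' : {linear P' -> M'}) :
  projective_module P -> projective_module P' ->
  short_exact i p -> short_exact i' p' -> stable_retract M M' -> stable_retract N N'.
Proof.
move=> Pp Pp' [i_inj ipE p_surj] [i'_inj ipE' p'_surj] [Q [a [b [u [v [Qp MM']]]]]].
have [A AE] := Pp _ _ p' (a \o p) p'_surj.
have [B BE] := Pp' _ _ p (b \o p') p_surj.
have [w wE] := Qp _ _ p v p_surj.
have pi x : p (i x) = 0 by apply/ipE; exists x.
have pi' x : p' (i' x) = 0 by apply/ipE'; exists x.
have [al alE] : exists al : {linear N -> N'}, forall x, i' (al x) = A (i x).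
  by apply: (@factor_mono _ _ _ i' (A \o i)) => // x; apply/ipE'; rewrite /= AE /= pi raddf0.
have [be beE] : exists be : {linear N' -> N}, forall x, i (be x) = B (i' x).
  by apply: (@factor_mono _ _ _ i (B \o i')) => // x; apply/ipE; rewrite /= BE /= pi' raddf0.
have [t tE] : exists t : {linear P -> N}, forall x, i (t x) = x - B (A x) - w (u (p x)).
  apply: (@factor_mono _ _ _ i (idfun \- (B \o A) \- (w \o (u \o p)))) => // x.
  by apply/ipE; rewrite /= !raddfB /= BE wE /= AE /= {1}(MM' (p x)) addrAC addrK subrr.
exists P, al, be, i, t; split=> // x.
apply: i_inj; rewrite raddfD /= beE tE /= alE /= pi (raddf0 u) (raddf0 w) subr0.
by rewrite addrC subrK.
Qed.

(** Projective dimension at most n, by dimension shifting.  Asking for one good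
syzygy is as strong as asking for all of them, by stable_retract_syzygy; this
is how pdle_stable_retract can use the free cover. *)
Fixpoint pdle (n : nat) M : Prop :=
  match n with
  | 0 => projective_module M
  | n'.+1 => exists N P (i : {linear N -> P}) (p : {linear P -> M}),
      [/\ projective_module P, short_exact i p & pdle n' N]
  end.

Lemma pdle_stable_retract n M N : stable_retract M N -> pdle n N -> pdle n M.
Proof.
elim: n M N => [|n IH] M N MN; first exact: stable_retract_projective.
move=> /= [N' [P [i [p [Pp ip N'n]]]]].
exists (kermod (free_cover M)), (freemod R M), (ker_incl _), (free_cover M).
have Mex := kernel_exact (@free_cover_surj M).
have Fp := @freemod_projective M.
split=> //; apply: IH N'n.
exact: stable_retract_syzygy Mex ip MN.
Qed.

(** The horseshoe lemma: covers of U and W add up to a cover of V, whose kernel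
is an extension of the two kernels. *)
Lemma pdle_ext n (U V W : lmodType R) (i : {linear U -> V}) (p : {linear V -> W}) :
  short_exact i p -> pdle n U -> pdle n W -> pdle n V.
Proof.
elim: n U V W i p => [|n IH] U V W i p [i_inj ipE p_surj].
  move=> Up Wp.
  have [s sE] := Wp _ _ p idfun p_surj.
  have [r rE] : exists r : {linear V -> U}, forall x, i (r x) = x - s (p x).
    apply: (@factor_mono _ _ _ i (idfun \- (s \o p))) => // x; apply/ipE.
    by rewrite /= raddfB /= sE subrr.
  apply: stable_retract_projective Up.
  by exists W, r, i, p, s; split=> // x; rewrite rE subrK.
move=> /= [NU [PU [iU [pU [PUp [iU_inj iUE pU_surj] NUn]]]]].
move=> /= [NW [PW [iW [pW [PWp [iW_inj iWE pW_surj] NWn]]]]].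
have [s sE] := PWp _ _ p pW p_surj.
have pi x : p (i x) = 0 by apply/ipE; exists x.
have q_lin : linear (fun x : PU * PW => i (pU x.1) + s x.2).
  by move=> k x y /=; rewrite !linearP /= scalerDr addrACA.
pose q := lin_of q_lin.
have q_surj : surj q.
  move=> v; have [c cE] := pW_surj (p v).
  have [|u uE] := (ipE (v - s c)).1; first by rewrite raddfB /= sE cE subrr.
  by have [a aE] := pU_surj u; exists (a, c); rewrite lin_ofE /= aE uE subrK.
(* The kernel of q is an extension of NW by NU through j and r. *)
exists (kermod q), (PU * PW)%type, (ker_incl q), q.
split; [exact: projective_pair|exact: kernel_exact|].
have j_lin : linear (fun x : NU => (iU x, 0 : PW)).
  by move=> k x y; congr (_, _); rewrite /= ?linearP// scaler0 addr0.
have pUi x : pU (iU x) = 0 by apply/iUE; exists x.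
have [j jE] : exists j : {linear NU -> kermod q}, forall x, ker_incl q (j x) = lin_of j_lin x.
  apply: factor_mono (@ker_incl_inj _ _ _ q) _ => x; apply/ker_inclE.
  by rewrite !lin_ofE /= pUi !raddf0 addr0.
have snd_lin : linear (fun x : kermod q => (ker_incl q x).2) by move=> k x y; rewrite linearP.
have kerq (x : kermod q) : i (pU (ker_incl q x).1) + s (ker_incl q x).2 = 0.
  by have := (ker_inclE q (ker_incl q x)).2 (ex_intro _ x erefl).
have [r rE] : exists r : {linear kermod q -> NW}, forall x, iW (r x) = lin_of snd_lin x.
  apply: factor_mono iW_inj _ => x; apply/iWE; rewrite lin_ofE -sE.
  by have /(congr1 p) := kerq x; rewrite raddfD /= pi add0r raddf0.
apply: (IH _ _ _ j r) => //; split.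
- by move=> x y /(congr1 (ker_incl q)); rewrite !jE => -[/iU_inj].
- move=> x; split=> [rx|[y <-]].
    have x2 : (ker_incl q x).2 = 0 by have := rE x; rewrite rx raddf0 lin_ofE => <-.
    have := kerq x; rewrite x2 raddf0 addr0 -(raddf0 i) => /i_inj /iUE[y yE].
    exists y; apply: ker_incl_inj; rewrite jE lin_ofE yE -x2.
    by case: (ker_incl q x).
  by apply: iW_inj; rewrite rE raddf0 lin_ofE jE.
- move=> n0; have [|u uE] := (ipE (- s (iW n0))).1.
    by rewrite raddfN /= sE; apply/eqP; rewrite oppr_eq0; apply/eqP/iWE; exists n0.
  have [a aE] := pU_surj u.
  have [|x xE] := (ker_inclE q (a, iW n0)).1.
    by rewrite lin_ofE /= aE uE addNr.
  by exists x; apply: iW_inj; rewrite rE lin_ofE xE.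
Qed.

(** Cover V by a projective P with kernel N.  The kernel of P -> W is an
extension of U by N, and both have dimension at most n. *)
Lemma pdle_quotient n (U V W : lmodType R) (i : {linear U -> V}) (p : {linear V -> W}) :
  short_exact i p -> pdle n U -> pdle n.+1 V -> pdle n.+1 W.
Proof.
move=> [i_inj ipE p_surj] Un /= [N [P [j [q [Pp [j_inj jqE q_surj] Nn]]]]].
have pq_surj : surj (p \o q).
  by move=> w; have [v <-] := p_surj w; have [x <-] := q_surj v; exists x.
exists (kermod (p \o q)), P, (ker_incl _), (p \o q).
split=> //; first exact: kernel_exact.
have qj x : q (j x) = 0 by apply/jqE; exists x.
have kerE (x : kermod (p \o q)) : p (q (ker_incl _ x)) = 0.
  by apply/(ker_inclE (p \o q)); exists x.
set j' := ker_incl _ in kerE *.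
have [k kE] : exists k : {linear N -> kermod (p \o q)}, forall x, j' (k x) = j x.
  apply: factor_mono (@ker_incl_inj _ _ _ _) _ => x; apply/ker_inclE.
  by rewrite /= qj raddf0.
have [r rE] : exists r : {linear kermod (p \o q) -> U}, forall x, i (r x) = q (j' x).
  by apply: (@factor_mono _ _ _ i (q \o j')) => // x; apply/ipE/kerE.
apply: (@pdle_ext n _ _ _ k r) => //; split.
- by move=> x y /(congr1 j'); rewrite !kE => /j_inj.
- move=> x; split=> [rx|[y <-]].
    have := rE x; rewrite rx raddf0 => /esym/jqE[y yE].
    by exists y; apply: ker_incl_inj; rewrite kE.
  by apply: i_inj; rewrite rE raddf0 kE qj.
- move=> u; have [x xE] := q_surj (i u).
  have [|y yE] := (ker_inclE (p \o q) x).1; first by rewrite /= xE; apply/ipE; exists u.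
  by exists y; apply: i_inj; rewrite rE yE.
Qed.

Lemma void_eq0 (x : freemod R void) : x = 0.
Proof. by apply/freemodP => -[]. Qed.

Lemma pdleS n M : pdle n M -> pdle n.+1 M.
Proof.
elim: n M => [|n IH] M /=.
  move=> Mp; exists (freemod R void), M, \0, idfun; split=> //; last exact: freemod_projective.
  split=> [x y _|x|x]; [by rewrite (void_eq0 x) (void_eq0 y)| |by exists x].
  by split=> [/= ->|[y <-]//]; exists 0.
move=> [N [P [i [p [Pp ip Nn]]]]]; exists N, P, i, p; split=> //; exact: IH.
Qed.

Lemma pdle_leq m n M : (m <= n)%N -> pdle m M -> pdle n M.
Proof. by move=> /subnK <-; elim: (n - m)%N => // k IH /IH/pdleS. Qed.

Lemma resolution_pdle n M : projective_resolution_le M n -> pdle n M.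
Proof.
elim: n M => [|n IH] M [P [d [eps [Pp eps_surj epsE dE P0]]]].
  have eps_inj : injective eps.
    move=> x y /eqP; rewrite -subr_eq0 -raddfB => /eqP /epsE[z zE].
    by apply/eqP; rewrite -subr_eq0 -zE (P0 1 _ z)// raddf0.
  have [s sE] := @factor_mono _ _ _ eps idfun eps_inj eps_surj.
  exact: stable_retract_projective (retract_stable sE) (Pp 0).
exists (kermod eps), (P 0), (ker_incl eps), eps.
split=> //; first exact: kernel_exact.
apply: IH.
have [e eE] : exists e : {linear P 1 -> kermod eps}, forall x, ker_incl eps (e x) = d 0 x.
  apply: factor_mono (@ker_incl_inj _ _ _ eps) _ => x.
  by apply/ker_inclE/epsE; exists x.
exists (fun i => P i.+1), (fun i => d i.+1), e; split=> //.
- move=> x; have /epsE[y yE] : eps (ker_incl eps x) = 0 by apply/ker_inclE; exists x.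
  by exists y; apply: ker_incl_inj; rewrite eE.
- move=> x; split=> [ex|]; last first.
    by move=> /dE dx; apply: ker_incl_inj; rewrite eE dx raddf0.
  by apply/dE; rewrite -eE ex raddf0.
- by move=> i ni; apply: P0.
Qed.

Definition splice_modules M (P : nat -> lmodType R) (i : nat) : lmodType R :=
  if i is i'.+1 then P i' else M.

Definition splice_maps M (P : nat -> lmodType R) (f : {linear P 0 -> M})
    (d : forall i, {linear P i.+1 -> P i}) (i : nat) :
    {linear splice_modules M P i.+1 -> splice_modules M P i} :=
  match i with 0 => f | i'.+1 => d i' end.

Lemma pdle_resolution n M : pdle n M -> projective_resolution_le M n.
Proof.
elim: n M => [|n IH] M /=.
  move=> Mp; exists (splice_modules M (fun _ => freemod R void)).
  exists (splice_maps (P := fun _ => freemod R void) (M := M) \0 (fun _ => \0)), idfun.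
  split=> [[|i]|m|x|[|i] x|[|i]] //=.
  - exact: freemod_projective.
  - by exists m.
  - by split=> [-> |[y <-]//]; exists 0.
  - by split=> // _; exists 0; rewrite (void_eq0 x).
  - by split=> // _; exists 0; rewrite (void_eq0 x).
  - by move=> _ x; apply: void_eq0.
move=> [N [P [i [p [Pp [i_inj ipE p_surj] /IH[Q [d [eps [Qp eps_surj epsE dE Q0]]]]]]]]].
exists (splice_modules P Q), (splice_maps (i \o eps) d), p.
split=> [[|k]|||[|k] x|[|k]] //=.
- move=> x; rewrite ipE; split=> [[y <-]|[z <-]]; last by exists (eps z).
  by have [z <-] := eps_surj y; exists z.
- by rewrite -epsE -[X in _ = X](raddf0 i); split=> [/i_inj//|->].
- exact: dE.
- by move=> nk; apply: Q0.
Qed.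

End ProjectiveDimension.

(** * Direct sums *)

(** Finitely supported families.  They serve twice: as direct sums of modules,
and as the additive group of X (x) B, since B is free over K on the
idempotents of the monoid. *)
Definition dsum (T : choiceType) (V : zmodType) : Type := {fsfun T -> V with 0}.

Section DirectSum.
Context (T : choiceType) (V : zmodType).
Local Notation F := (dsum T V).
Local Open Scope fset_scope.
Local Open Scope ring_scope.
Implicit Types f g : F.

HB.instance Definition _ := Choice.on F.

Definition dcoef (t : T) (f : F) : V := (f : {fsfun T -> V with 0}) t.
Definition dsupp (f : F) : {fset T} := finsupp (f : {fsfun T -> V with 0}).

Lemma dsumP f g : (forall t, dcoef t f = dcoef t g) <-> f = g.
Proof. exact: (fsfunP (f : {fsfun _ -> _ with _}) g). Qed.

Lemma dcoef_out f t : t \notin dsupp f -> dcoef t f = 0.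
Proof. by rewrite mem_finsupp negbK => /eqP. Qed.

Definition dzero : F := [fsfun].
Definition dadd : F -> F -> F := locked_with lock_key (fun f g =>
  [fsfun t in dsupp f `|` dsupp g => (dcoef t f + dcoef t g)%R]).
Definition dopp : F -> F := locked_with lock_key (fun f =>
  [fsfun t in dsupp f => - dcoef t f]).
Definition dinj (t : T) : V -> F := locked_with lock_key (fun v =>
  [fsfun x in [fset t] => v]).

Lemma dcoef_zero t : dcoef t dzero = 0.
Proof. by rewrite /dcoef /dzero fsfunE. Qed.

Lemma dcoef_add f g t : dcoef t (dadd f g) = dcoef t f + dcoef t g.
Proof.
rewrite /dadd unlock {1}/dcoef fsfunE inE; case: ifPn => // /norP[/dcoef_out-> /dcoef_out->].
by rewrite addr0.
Qed.

Lemma dcoef_opp f t : dcoef t (dopp f) = - dcoef t f.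
Proof.
rewrite /dopp unlock {1}/dcoef fsfunE.
by case: ifPn => // /dcoef_out->; rewrite oppr0.
Qed.

Lemma dcoef_dinj t v x : dcoef x (dinj t v) = if x == t then v else 0.
Proof. by rewrite /dinj unlock /dcoef fsfunE inE. Qed.

Fact daddA : associative dadd.
Proof. by move=> f g h; apply/dsumP => t; rewrite !dcoef_add addrA. Qed.
Fact daddC : commutative dadd.
Proof. by move=> f g; apply/dsumP => t; rewrite !dcoef_add addrC. Qed.
Fact dadd0 : left_id dzero dadd.
Proof. by move=> f; apply/dsumP => t; rewrite dcoef_add dcoef_zero add0r. Qed.
Fact daddN : left_inverse dzero dopp dadd.
Proof. by move=> f; apply/dsumP => t; rewrite dcoef_add dcoef_opp dcoef_zero addNr. Qed.

HB.instance Definition _ := GRing.isZmodule.Build F daddA daddC dadd0 daddN.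

Lemma dcoefD t : {morph dcoef t : f g / f + g}.
Proof. by move=> f g; apply: dcoef_add. Qed.

Lemma dinjD t : {morph dinj t : u v / u + v}.
Proof.
move=> u v; apply/dsumP => x; rewrite dcoefD !dcoef_dinj.
by case: (x == t); rewrite ?addr0.
Qed.

Lemma morphD0 (U W : zmodType) (h : U -> W) : {morph h : u v / u + v} -> h 0 = 0.
Proof. by move=> hD; apply: (addrI (h 0)); rewrite -hD !addr0. Qed.

Lemma dcoef_sum t (I : Type) (s : seq I) (h : I -> F) :
  dcoef t (\sum_(i <- s) h i) = \sum_(i <- s) dcoef t (h i).
Proof. exact: (big_morph _ (dcoefD t) (dcoef_zero t)). Qed.

Lemma dsum_sum f : f = \sum_(t <- dsupp f) dinj t (dcoef t f).
Proof.
apply/dsumP => t; rewrite dcoef_sum.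
under eq_bigr => i do rewrite dcoef_dinj eq_sym.
rewrite -big_mkcond /=; case: (boolP (t \in dsupp f)) => tf.
  by rewrite -big_filter filter_pred1_uniq ?fset_uniq ?big_seq1.
by rewrite dcoef_out// big_seq_cond big1// => i /andP[+ /eqP ti]; rewrite ti (negPf tf).
Qed.

Lemma dsum_ind (P : F -> Prop) :
  P 0 -> (forall t v f, P f -> P (dinj t v + f)) -> forall f, P f.
Proof.
move=> P0 PD f; rewrite (dsum_sum f).
elim: (enum_fset (dsupp f)) => [|t s IH]; first by rewrite big_nil.
by rewrite big_cons; apply: PD.
Qed.

(** The map out of a direct sum given by its components.  These stay unbundled
because they are linear over different rings in the different uses. *)
Definition glue (W : zmodType) : (T -> V -> W) -> F -> W :=
  locked_with lock_key (fun phi f => \sum_(t <- dsupp f) phi t (dcoef t f)).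

Section Glue.
Context (W : zmodType) (phi : T -> V -> W) (phiD : forall t, {morph phi t : u v / u + v}).

Lemma glue_sub (A : {fset T}) f : dsupp f `<=` A ->
  glue phi f = \sum_(t <- A) phi t (dcoef t f).
Proof.
move=> sfA; rewrite /glue unlock; apply: big_fset_incl => // t _ /dcoef_out ->.
exact: morphD0.
Qed.

Lemma glueD : {morph glue phi : f g / f + g}.
Proof.
move=> f g; set A := dsupp f `|` dsupp g `|` dsupp (f + g).
rewrite (@glue_sub A f) ?(@glue_sub A g) ?(@glue_sub A (_ + _)).
- by rewrite -big_split; apply: eq_bigr => t _ /=; rewrite dcoefD phiD.
- by apply/fsubsetP => t tf; rewrite !inE tf ?orbT.
- by apply/fsubsetP => t tf; rewrite !inE tf ?orbT.
- by apply/fsubsetP => t tf; rewrite !inE tf ?orbT.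
Qed.

Lemma glue0 : glue phi 0 = 0. Proof. exact/morphD0/glueD. Qed.

Lemma glue_dinj t v : glue phi (dinj t v) = phi t v.
Proof.
rewrite (@glue_sub [fset t]); last first.
  by apply/fsubsetP => x; rewrite mem_finsupp -/(dcoef _ _) dcoef_dinj inE;
    case: (x == t); rewrite ?eqxx.
by rewrite big_seq_fset1 dcoef_dinj eqxx.
Qed.

End Glue.

Lemma dsum_ext (W : zmodType) (h1 h2 : F -> W) :
  {morph h1 : f g / f + g} -> {morph h2 : f g / f + g} ->
  (forall t v, h1 (dinj t v) = h2 (dinj t v)) -> h1 =1 h2.
Proof.
move=> h1D h2D e; elim/dsum_ind => [|t v f IH]; first by rewrite !morphD0.
by rewrite h1D h2D e IH.
Qed.

End DirectSum.

Section DirectSumModule.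
Context (R : pzRingType) (T : choiceType) (V : lmodType R).
Local Notation F := (dsum T V).
Local Open Scope fset_scope.
Local Open Scope ring_scope.
Implicit Types f g : F.

Definition dscale : R -> F -> F := locked_with lock_key (fun k f =>
  [fsfun t in dsupp f => k *: dcoef t f]).

Lemma dcoef_scale k f t : dcoef t (dscale k f) = k *: dcoef t f.
Proof.
rewrite /dscale unlock {1}/dcoef fsfunE.
by case: ifPn => // /dcoef_out->; rewrite scaler0.
Qed.

Fact dscaleA a b f : dscale a (dscale b f) = dscale (a * b) f.
Proof. by apply/dsumP => t; rewrite !dcoef_scale scalerA. Qed.
Fact dscale1 : left_id 1 dscale.
Proof. by move=> f; apply/dsumP => t; rewrite dcoef_scale scale1r. Qed.
Fact dscaleDr : right_distributive dscale +%R.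
Proof.
by move=> k f g; apply/dsumP => t; rewrite dcoef_scale !dcoefD !dcoef_scale scalerDr.
Qed.
Fact dscaleDl f : {morph dscale^~ f : a b / a + b}.
Proof. by move=> a b; apply/dsumP => t; rewrite dcoefD !dcoef_scale scalerDl. Qed.

HB.instance Definition _ :=
  GRing.Zmodule_isLmodule.Build R F dscaleA dscale1 dscaleDr dscaleDl.

Lemma dcoefZ t k f : dcoef t (k *: f) = k *: dcoef t f.
Proof. exact: dcoef_scale. Qed.

Lemma dinj_linear t : linear (dinj t : V -> F).
Proof.
move=> k u v; apply/dsumP => x; rewrite dcoefD dcoefZ !dcoef_dinj.
by case: (x == t); rewrite ?scaler0 ?addr0.
Qed.

HB.instance Definition _ t := GRing.isLinear.Build R V F _ (dinj t) (dinj_linear t).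

Lemma glue_linear (W : lmodType R) (phi : T -> V -> W) :
  (forall t, linear (phi t)) -> linear (glue phi).
Proof.
move=> phi_lin k f g.
have phiD t : {morph phi t : u v / u + v}.
  by move=> u v; have := phi_lin t 1 u v; rewrite !scale1r.
rewrite glueD//; congr (_ + _); elim/dsum_ind: f => [|t v f IH].
  by rewrite scaler0 glue0// scaler0.
rewrite scalerDr !glueD// IH scalerDr -linearZ /= !glue_dinj//; congr (_ + _).
have := phi_lin t k v 0; rewrite !addr0 => ->.
by rewrite (morphD0 (phiD t)) addr0.
Qed.

End DirectSumModule.

Definition add_of (U V : zmodType) (f : U -> V) (fD : {morph f : u v / u + v}) :
    {additive U -> V} :=
  HB.pack f (GRing.isNmodMorphism.Build U V f (conj (morphD0 fD) fD)).

Section DirectSumMap.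
Context (T : choiceType) (V W : zmodType).

Definition dmap (h : V -> W) : dsum T V -> dsum T W := glue (fun t v => dinj t (h v)).

Context (h : {additive V -> W}).

Let phiD (t : T) : {morph (fun v => dinj t (h v)) : u v / u + v}.
Proof. by move=> u v; rewrite raddfD dinjD. Qed.

Lemma dmapD : {morph dmap h : f g / f + g}.
Proof. exact: glueD. Qed.

Lemma dmap_dinj t v : dmap h (dinj t v) = dinj t (h v).
Proof. exact: glue_dinj. Qed.

Lemma dcoef_dmap t f : dcoef t (dmap h f) = h (dcoef t f).
Proof.
apply: (@dsum_ext _ _ _ (dcoef t \o dmap h) (h \o dcoef t)) f => [f g|f g|x v] /=.
- by rewrite dmapD dcoefD.
- by rewrite dcoefD raddfD.
- by rewrite dmap_dinj !dcoef_dinj; case: eqP; rewrite ?raddf0.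
Qed.

End DirectSumMap.

Lemma dmap_exact (T : choiceType) (U V W : zmodType)
    (i : {additive U -> V}) (p : {additive V -> W}) :
  short_exact i p -> short_exact (@dmap T _ _ i) (@dmap T _ _ p).
Proof.
move=> [i_inj ipE p_surj]; split.
- by move=> f g fg; apply/dsumP => t; apply: i_inj; rewrite -!dcoef_dmap fg.
- move=> f; split=> [pf|[g <-]]; last first.
    by apply/dsumP => t; rewrite !dcoef_dmap dcoef_zero; apply/ipE; exists (dcoef t g).
  have /choice[n nE] : forall t, exists y, i y = dcoef t f.
    by move=> t; apply/ipE; rewrite -dcoef_dmap pf dcoef_zero.
  exists (\sum_(t <- dsupp f) dinj t (n t)).
  rewrite (big_morph (dmap i) (@dmapD _ _ _ i) (morphD0 (@dmapD _ _ _ i))).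
  by rewrite [RHS]dsum_sum; apply: eq_bigr => t _; rewrite dmap_dinj nE.
- elim/dsum_ind=> [|t w f [g <-]]; first by exists 0; apply: morphD0 (@dmapD _ _ _ p).
  by have [v <-] := p_surj w; exists (dinj t v + g); rewrite dmapD dmap_dinj.
Qed.

Lemma dmap_linear (R : pzRingType) (T : choiceType) (V W : lmodType R) (h : {linear V -> W}) :
  linear (@dmap T _ _ h).
Proof. by apply: glue_linear => t k u v; rewrite !linearP. Qed.

Lemma dsum_projective (R : pzRingType) (T : choiceType) (P : lmodType R) :
  projective_module P -> projective_module (dsum T P).
Proof.
move=> Pp U V p f p_surj.
have /choice[g gE] : forall t, exists g : {linear P -> U}, forall x, p (g x) = f (dinj t x).
  by move=> t; apply: (Pp _ _ p (f \o dinj t)).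
have g_lin : linear (glue (fun t => g t)) by apply: glue_linear => t; apply: linearP.
exists (lin_of g_lin); apply: (@dsum_ext _ _ _ (p \o lin_of g_lin) f).
- by move=> x y; apply: (raddfD (p \o lin_of g_lin)).
- by move=> x y; rewrite raddfD.
- by move=> t v; rewrite /= -gE glue_dinj// => {}t x y; rewrite raddfD.
Qed.

Lemma pdle_dsum (R : pzRingType) (T : choiceType) n (M : lmodType R) :
  pdle n M -> pdle n (dsum T M).
Proof.
elim: n M => [|n IH] M /=; first exact: dsum_projective.
move=> [N [P [i [p [Pp ip /IH Nn]]]]].
exists (dsum T N), (dsum T P), (lin_of (dmap_linear (T := T) i)), (lin_of (dmap_linear (T := T) p)).
by split=> //; [exact: dsum_projective|exact: dmap_exact].
Qed.

(** * The functor X |-> X (x) B from KG-modules to partial modules *)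

Definition ract (R : pzRingType) (V : rmodType R) (v : V) (r : R) : V := (r : R^c) *: v.
Notation "v ◁ r" := (ract v r) (at level 40, left associativity).

Section RightAction.
Context (R : pzRingType) (V : rmodType R).
Implicit Types (u v : V) (r s : R).

Lemma ractDl u v r : (u + v) ◁ r = u ◁ r + v ◁ r. Proof. exact: scalerDr. Qed.
Lemma ractDr v r s : v ◁ (r + s) = v ◁ r + v ◁ s. Proof. exact: scalerDl. Qed.
Lemma ractBl u v r : (u - v) ◁ r = u ◁ r - v ◁ r. Proof. exact: scalerBr. Qed.
Lemma ractM v r s : v ◁ (r * s) = v ◁ r ◁ s. Proof. by rewrite [RHS]scalerA. Qed.
Lemma ract1 v : v ◁ 1 = v. Proof. exact: scale1r. Qed.
Lemma ract0 v : v ◁ 0 = 0. Proof. exact: scale0r. Qed.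
Lemma ract0l r : (0 : V) ◁ r = 0. Proof. exact: scaler0. Qed.
Lemma ract_map (W : rmodType R) (f : {linear V -> W}) v r : f (v ◁ r) = f v ◁ r.
Proof. exact: linearZ. Qed.

End RightAction.

Section SemigroupModules.
Context (K : comPzRingType) (M : monoidType).
Local Notation A := (semigroup_algebra K M).

Definition scal (k : K) : A := k *: (1 : A).

Lemma scalM k l : scal (k * l) = scal k * scal l.
Proof. by rewrite /scal -sa_scalerAl mul1r scalerA. Qed.

Lemma scal_mul k (a : A) : scal k * a = k *: a.
Proof. by rewrite /scal -sa_scalerAl mul1r. Qed.

Lemma mul_scal k (a : A) : a * scal k = k *: a.
Proof. by rewrite /scal -sa_scalerAr mulr1. Qed.

Lemma scalC k (a : A) : a * scal k = scal k * a.
Proof. by rewrite mul_scal scal_mul. Qed.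

Lemma ract_lin (V : rmodType A) (v : V) k r s :
  v ◁ (k *: r + s) = v ◁ r ◁ scal k + v ◁ s.
Proof. by rewrite ractDr -ractM mul_scal. Qed.

(** K acts on a right K[M]-module through the multiples of 1; a separate name
for the carrier keeps this action apart from that of K[M]. *)
Definition scalar_res (V : rmodType A) : Type := V.

Section Restriction.
Context (V : rmodType A).

HB.instance Definition _ := GRing.Zmodule.on (scalar_res V).

Definition kres_scale (k : K) (v : scalar_res V) : scalar_res V := (v : V) ◁ scal k.

Fact kres_scaleA a b v : kres_scale a (kres_scale b v) = kres_scale (a * b) v.
Proof. by rewrite /kres_scale -ractM -scalM mulrC. Qed.

Fact kres_scale1 : left_id 1 kres_scale.
Proof. by move=> v; rewrite /kres_scale /scal scale1r ract1. Qed.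

Fact kres_scaleDr : right_distributive kres_scale +%R.
Proof. by move=> k u v; apply: ractDl. Qed.

Fact kres_scaleDl v : {morph kres_scale^~ v : a b / a + b}.
Proof. by move=> a b; rewrite /kres_scale -ractDr /scal scalerDl. Qed.

HB.instance Definition _ := GRing.Zmodule_isLmodule.Build K (scalar_res V)
  kres_scaleA kres_scale1 kres_scaleDr kres_scaleDl.

Lemma scalar_resE k (v : scalar_res V) : k *: v = (v : V) ◁ scal k. Proof. by []. Qed.

End Restriction.

Lemma semigroup_linear (V W : rmodType A) (f : V -> W) :
  {morph f : u v / u + v} -> (forall k v, f (v ◁ scal k) = f v ◁ scal k) ->
  (forall x v, f (v ◁ sa_elt K x) = f v ◁ sa_elt K x) -> linear f.
Proof.
move=> fD fK fM r u v; rewrite fD; congr (_ + _).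
rewrite -[LHS]/(f (u ◁ r)) -[RHS]/(f u ◁ r).
elim/sa_ind: (r : A) => [|k x a IH]; first by rewrite !ract0 (morphD0 fD).
by rewrite !ract_lin fD IH fK fM.
Qed.

End SemigroupModules.

Section Exel.
Context (G : groupType).
Local Notation S := (exel_monoid G).
Local Notation e := (@exel_e G).
Local Open Scope group_scope.
Implicit Types (x y : S) (g h : G).

Lemma exel_idemC x y : exel_idem x -> exel_idem y -> x * y = y * x.
Proof.
move=> /exel_idemP[s ->] /exel_idemP[t ->].
elim: s => [|a s IH] /=; first by rewrite mul1g mulg1.
by rewrite -mulgA IH (mulgA (e a)) (exel_e_eprodC a t) -(mulgA _ (e a)).
Qed.

Lemma exel_e_is_idem g : exel_idem (e g). Proof. exact: exel_e_idem. Qed.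

Lemma exel_idem1 : exel_idem (1 : S). Proof. exact: mulg1. Qed.

Lemma exel_eV g : (e g)^-1 = e g.
Proof. by rewrite /e invgM !exel_genV invgK. Qed.

Lemma exel_idemV x : exel_idem x -> x^-1 = x.
Proof.
move=> /exel_idemP[s ->]; elim: s => [|a s IH] /=; first exact: invg1.
by rewrite invgM IH exel_eV exel_e_eprodC.
Qed.

Lemma exel_idem_deg x : exel_idem x -> exel_deg x = 1.
Proof. by move=> /exel_idemP[s ->]; apply: exel_deg_eprod. Qed.

Lemma exel_deg1 : exel_deg (1 : S) = 1.
Proof. exact/exel_idem_deg/exel_idem1. Qed.

Lemma exel_eE g : exel_gen g^-1 * exel_gen g = e g^-1.
Proof. by rewrite /e invgK. Qed.

Lemma exel_idem_gen x g : exel_idem x -> e g * (x * exel_gen g) = x * exel_gen g.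
Proof.
move=> xx; rewrite (mulgA (e g)) (exel_idemC (exel_e_is_idem g) xx) -mulgA.
by congr (_ * _); apply: exel_genK.
Qed.

Definition idem_elt : Type := {x : S | `[< exel_idem x >]}.
HB.instance Definition _ := Choice.on idem_elt.

Definition idem_of x (xx : exel_idem x) : idem_elt := exist _ x (asboolT xx).

Lemma idem_eltP (t : idem_elt) : exel_idem (val t). Proof. exact/asboolP/(valP t). Qed.

Definition idem1 : idem_elt := idem_of exel_idem1.
Definition idem_conj x (t : idem_elt) : idem_elt := idem_of (exel_idem_conj x (idem_eltP t)).

Lemma idem_conj1 t : idem_conj 1 t = t.
Proof. by apply: val_inj; rewrite /= invg1 mul1g mulg1. Qed.

Lemma idem_conjM x y t : idem_conj (x * y) t = idem_conj y (idem_conj x t).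
Proof. by apply: val_inj; rewrite /= invgM !mulgA. Qed.

End Exel.

Section ParLinear.
Context (K : comPzRingType) (G : groupType).
Local Notation A := (par_algebra K G).
Local Notation "[ g ]" := (sa_elt K (exel_gen g)).

Lemma par_linear (V W : rmodType A) (f : V -> W) :
  {morph f : u v / u + v} -> (forall k v, f (v ◁ scal _ k) = f v ◁ scal _ k) ->
  (forall g v, f (v ◁ [g]) = f v ◁ [g]) -> linear f.
Proof.
move=> fD fK fG; apply: semigroup_linear => // x.
elim/exel_ind: x => [|g x IH] v; first by rewrite sa_elt1 !ract1.
by rewrite sa_eltM !ractM IH fG.
Qed.

End ParLinear.

Section Diagonal.
Context (K : comPzRingType) (G : groupType).
Local Notation KG := (group_algebra K G).
Local Notation A := (par_algebra K G).
Local Notation "[ g ]" := (sa_elt K (exel_gen g)).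
Local Notation e g := (sa_elt K (exel_e g)).

(** The module X (x) B, where x in the monoid acts by
(p (x) t) x = p deg(x) (x) x^-1 t x.  The component of a family at an
idempotent t is the coefficient of t, so that exactness in X is visible
componentwise, which it is not on X (x)_KG L. *)
Definition diag (X : rmodType KG) : Type := dsum (idem_elt G) (scalar_res X).

Section Structure.
Context (X : rmodType KG).
Local Notation D := (dsum (idem_elt G) (scalar_res X)).

HB.instance Definition _ := GRing.Zmodule.on (diag X).

Definition translate (x : exel_monoid G) : D -> D :=
  glue (fun t (p : scalar_res X) =>
    dinj (idem_conj x t) ((p : X) ◁ sa_elt K (exel_deg x) : scalar_res X)).

Fact translate_linear x : linear (translate x).
Proof.
apply: glue_linear => t k u v.
rewrite -linearP; congr dinj.
by rewrite scalar_resE ractDl [RHS]addrC scalar_resE -!ractM scalC addrC.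
Qed.

Lemma translate_dinj x t (p : X) :
  translate x (dinj t (p : scalar_res X)) =
  dinj (idem_conj x t) (p ◁ sa_elt K (exel_deg x) : scalar_res X).
Proof. by rewrite /translate glue_dinj// => {}t u v; rewrite ractDl dinjD. Qed.

Lemma translateD x : {morph translate x : f g / f + g}.
Proof. by move=> f g; have := translate_linear x 1 f g; rewrite !scale1r. Qed.

Lemma translate1 f : translate 1%g f = f.
Proof.
elim/dsum_ind: f => [|t v f IH]; first exact: morphD0 (translateD _).
by rewrite translateD IH translate_dinj idem_conj1 exel_deg1 sa_elt1 ract1.
Qed.

Lemma translateM x y f : translate (x * y)%g f = translate y (translate x f).
Proof.
elim/dsum_ind: f => [|t v f IH]; first by rewrite !(morphD0 (translateD _)).
by rewrite !translateD IH !translate_dinj idem_conjM exel_degM sa_eltM ractM.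
Qed.

Definition diag_scale (r : A^c) (f : diag X) : diag X :=
  flift (fun x => translate x f) (r : A).

Lemma diag_scale_lin (r : A) k (f g : D) :
  diag_scale r (k *: f + g) = k *: (diag_scale r f : D) + diag_scale r g.
Proof.
rewrite /diag_scale -flift_linear_fun; apply: flift_ext => x.
exact: translate_linear.
Qed.

Lemma diag_scale_linl (r s : A) k (f : D) :
  diag_scale (k *: r + s) f = k *: (diag_scale r f : D) + diag_scale s f.
Proof. exact: linearP. Qed.

Lemma diag_scale_elt x f : diag_scale (sa_elt K x) f = translate x f.
Proof. exact: flift_single. Qed.

Lemma diag_scale0l f : diag_scale 0 f = 0.
Proof. exact: raddf0. Qed.

Fact diag_scaleDr : right_distributive diag_scale +%R.
Proof. by move=> r f g; have := diag_scale_lin r 1 f g; rewrite !scale1r. Qed.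

Fact diag_scaleDl f : {morph diag_scale^~ f : a b / a + b}.
Proof. by move=> a b; have := diag_scale_linl a b 1 f; rewrite !scale1r. Qed.

Lemma diag_scale0 r : diag_scale r 0 = 0.
Proof. exact: morphD0 (diag_scaleDr r). Qed.

Lemma diag_scaleM (r s : A) f : diag_scale s (diag_scale r f) = diag_scale (r * s) f.
Proof.
elim/sa_ind: r s => [|k x r IH] s; first by rewrite mul0r !diag_scale0l diag_scale0.
rewrite sa_linl !diag_scale_linl diag_scale_lin IH; congr (_ *: _ + _).
elim/sa_ind: s => [|k' y s IH2]; first by rewrite mulr0 !diag_scale0l.
by rewrite sa_linr !diag_scale_linl IH2 -sa_eltM !diag_scale_elt translateM.
Qed.

Fact diag_scaleA a b f : diag_scale a (diag_scale b f) = diag_scale (a * b) f.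
Proof. exact: diag_scaleM. Qed.

Fact diag_scale1 : left_id 1 diag_scale.
Proof. by move=> f; rewrite [LHS]diag_scale_elt translate1. Qed.

HB.instance Definition _ := GRing.Zmodule_isLmodule.Build A^c (diag X)
  diag_scaleA diag_scale1 diag_scaleDr diag_scaleDl.

Lemma diag_ract_elt x (f : diag X) : f ◁ sa_elt K x = translate x f.
Proof. exact: diag_scale_elt. Qed.

Lemma diag_ract_scal k (f : diag X) : f ◁ scal _ k = k *: (f : D).
Proof.
have := diag_scale_linl 1 0 k f.
by rewrite diag_scale0l !addr0 diag_scale1.
Qed.

Definition unit_diag (p : X) : diag X := dinj (idem1 G) (p : scalar_res X).

Lemma unit_diagD : {morph unit_diag : p q / p + q}.
Proof. exact: dinjD. Qed.

Lemma unit_diag_scal p k : unit_diag (p ◁ scal _ k) = unit_diag p ◁ scal _ k.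
Proof. by rewrite diag_ract_scal -linearZ. Qed.

Lemma unit_diag_elt p x :
  unit_diag p ◁ sa_elt K x =
  dinj (idem_conj x (idem1 G)) (p ◁ sa_elt K (exel_deg x) : scalar_res X).
Proof. by rewrite diag_ract_elt translate_dinj. Qed.

Lemma unit_diag_idem p (t : idem_elt G) :
  unit_diag p ◁ sa_elt K (val t) = dinj t (p : scalar_res X).
Proof.
have tt := idem_eltP t.
rewrite unit_diag_elt (exel_idem_deg tt) sa_elt1 ract1; congr dinj.
by apply: val_inj; rewrite /= mulg1 (exel_idemV tt).
Qed.

End Structure.

(** The relations (p g) e_(g^-1) = p [g] are those of the generators p (x) 1 in
X (x)_KG L.  Hence compatible maps j are exactly what extends to a linear map
out of diag X, and out of L itself when X = KG. *)
Definition par_compatible (X : rmodType KG) (Y : rmodType A) (j : X -> Y) : Prop :=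
  [/\ {morph j : p q / p + q},
      forall k p, j (p ◁ scal _ k) = j p ◁ scal _ k
    & forall g p, j (p ◁ sa_elt K g) ◁ e g^-1%g = j p ◁ [g]].

Lemma unit_diag_compatible (X : rmodType KG) : par_compatible (@unit_diag X).
Proof.
split=> [|k p|g p]; [exact: unit_diagD|exact: unit_diag_scal|].
rewrite !unit_diag_elt exel_deg_gen (exel_idem_deg (exel_e_is_idem _)) sa_elt1 ract1.
congr dinj; apply: val_inj.
by rewrite /= !mulg1 exel_eV exel_e_idem exel_genV exel_eE.
Qed.

Section Extension.
Context (X : rmodType KG) (Y : rmodType A) (j : X -> Y) (jP : par_compatible j).

Definition diag_ext : diag X -> Y :=
  glue (fun (t : idem_elt G) (p : scalar_res X) => j p ◁ sa_elt K (val t)).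

Let jD t : {morph (fun p : scalar_res X => j p ◁ sa_elt K (val (t : idem_elt G))) : p q / p + q}.
Proof. by case: jP => jD _ _ p q; rewrite jD ractDl. Qed.

Lemma diag_ext_dinj t (p : X) : diag_ext (dinj t (p : scalar_res X)) = j p ◁ sa_elt K (val t).
Proof. exact: glue_dinj. Qed.

Lemma diag_extD : {morph diag_ext : f g / f + g}.
Proof. exact: glueD. Qed.

(** Linearity in the generator [g] amounts to j (p g) [g^-1] = j p e_g, which is
compatibility at the element p g and the group element g^-1. *)
Lemma diag_ext_linear : linear diag_ext.
Proof.
have [_ jK jG] := jP.
apply: par_linear => [|k f|g f]; first exact: diag_extD.
  rewrite diag_ract_scal; elim/dsum_ind: f => [|t p f IH].
    by rewrite scaler0 (morphD0 diag_extD) ract0l.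
  rewrite scalerDr !diag_extD IH ractDl -linearZ /= !diag_ext_dinj scalar_resE jK.
  by rewrite -!ractM scalC.
rewrite diag_ract_elt; elim/dsum_ind: f => [|t p f IH].
  by rewrite (morphD0 (translateD _)) (morphD0 diag_extD) ract0l.
rewrite translateD !diag_extD IH ractDl; congr (_ + _).
rewrite translate_dinj !diag_ext_dinj exel_deg_gen /=.
have := jG g^-1%g (p ◁ sa_elt K g).
rewrite -ractM -sa_eltM mulgV sa_elt1 ract1 invgK => jg.
rewrite exel_genV 2!sa_eltM !ractM -jg -!ractM -!sa_eltM; congr (_ ◁ sa_elt K _).
exact: exel_idem_gen (idem_eltP t).
Qed.

Lemma diag_ext_unit p : diag_ext (unit_diag p) = j p.
Proof. by rewrite /unit_diag diag_ext_dinj sa_elt1 ract1. Qed.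

End Extension.

Lemma diag_ind_linear (X : rmodType KG) (Y : rmodType A) (f g : {linear diag X -> Y}) :
  (forall p, f (unit_diag p) = g (unit_diag p)) -> f =1 g.
Proof.
move=> fg; apply: dsum_ext => [u v|u v|t p]; try exact: raddfD.
by rewrite -unit_diag_idem !ract_map fg.
Qed.

Lemma diag_map_linear (X Y : rmodType KG) (f : {linear X -> Y}) :
  linear (dmap f : diag X -> diag Y).
Proof.
have fD := @dmapD (idem_elt G) _ _ f.
apply: semigroup_linear => [|k v|x v]; first exact: fD.
  apply/dsumP => t; rewrite !diag_ract_scal dcoefZ !dcoef_dmap.
  apply: etrans (congr1 f (dcoefZ t k (v : dsum _ (scalar_res X)))) _.
  exact: (ract_map f).
rewrite !diag_ract_elt; elim/dsum_ind: v => [|t p v IH].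
  by rewrite (morphD0 fD) !(morphD0 (translateD _)) (morphD0 fD).
rewrite fD !translateD fD IH dmap_dinj !translate_dinj dmap_dinj.
by congr (dinj _ _ + _); apply: (ract_map f).
Qed.

(** This is the flatness of L as a left KG-module. *)
Lemma diag_exact (N P X : rmodType KG) (i : {linear N -> P}) (p : {linear P -> X}) :
  short_exact i p ->
  short_exact (lin_of (diag_map_linear i)) (lin_of (diag_map_linear p)).
Proof. exact: dmap_exact. Qed.

End Diagonal.

(** * The globalization KG (x) K_par G *)

Section ParTensor.
Context (K : comPzRingType) (G : groupType).
Local Notation KG := (group_algebra K G).
Local Notation A := (par_algebra K G).
Local Notation "[ g ]" := (sa_elt K (exel_gen g)).
Local Notation e g := (sa_elt K (exel_e g)).

Definition regular : rmodType KG := ((KG^c)^o)%type.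

Lemma regular_ract (c d : KG) : (c : regular) ◁ d = c * d. Proof. by []. Qed.

Definition par_unit (c : regular) : par_tensor K G :=
  qpi (@par_tensor_relations K G) (tens (c : KG) (1 : A)).

Lemma par_tensor_ract t (r : A) :
  (qpi (@par_tensor_relations K G) t : par_tensor K G) ◁ r = qpi _ (tens_act r t).
Proof. exact: par_tensor_scaleE. Qed.

Lemma par_unit_ract (c : KG) (r : A) : par_unit c ◁ r = qpi _ (tens c r).
Proof. by rewrite par_tensor_ract tens_actE mul1r. Qed.

Lemma par_unit_lin k (c d : KG) :
  par_unit (k *: c + d) = par_unit c ◁ scal _ k + par_unit d.
Proof.
rewrite par_unit_ract {1}/par_unit tens_linl raddfD /=; congr (_ + _).
have := tens_linr k c (1 : A) 0; rewrite addr0.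
have -> : tens c (0 : A) = 0.
  have := tens_linr 1 c (0 : A) 0; rewrite !scale1r addr0 => /eqP.
  by rewrite -subr_eq subrr eq_sym => /eqP.
by rewrite addr0 => <-.
Qed.

Lemma par_unitD : {morph par_unit : c d / c + d}.
Proof.
by move=> c d; have := par_unit_lin 1 c d; rewrite /scal !scale1r ract1.
Qed.

Lemma par_unit_scal k (c : KG) : par_unit (c * scal _ k) = par_unit c ◁ scal _ k.
Proof.
by have := par_unit_lin k c 0; rewrite addr0 (morphD0 par_unitD) addr0 mul_scal.
Qed.

(** By linearity in c this reduces to group elements, where it is the relation
defining L with third entry 1. *)
Lemma par_unit_compatible : par_compatible par_unit.
Proof.
split=> [|k c|g c]; [exact: par_unitD|exact: par_unit_scal|].
rewrite regular_ract; elim/sa_ind: (c : KG) => [|k x d IH].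
  by rewrite mul0r (morphD0 par_unitD) !ract0l.
rewrite sa_linl !par_unit_lin !ractDl IH -!ractM -!scalC !ractM; congr (_ ◁ _ + _).
rewrite -sa_eltM !par_unit_ract.
by have /qpiP := Defs.sub_span (ParTensorRel x g (1 : A)); rewrite !mulr1.
Qed.

Section Extension.
Context (Y : rmodType A) (j : regular -> Y) (jP : par_compatible j).

Let jlin k (c d : KG) : j (k *: c + d) = j c ◁ scal _ k + j d.
Proof. by case: jP => jD jK _; rewrite jD -mul_scal -jK. Qed.

Let h0 (x : KG * A) : scalar_res Y := j x.1 ◁ x.2.
Let h1 : tensor KG A -> scalar_res Y := qlift (flift h0).

Let h1E f : h1 (qpi _ f) = flift h0 f.
Proof.
apply: qliftE => _ [k a a' b|k a b b']; rewrite raddfB /= linearP /= !flift_single /h0 /=.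
  by rewrite jlin ractDl scalar_resE -!ractM scalC subrr.
by rewrite ract_lin subrr.
Qed.

Let h1_tens a b : h1 (tens a b) = j a ◁ b.
Proof. by rewrite h1E flift_single. Qed.

Let h1_lin : linear h1.
Proof.
move=> k; elim/qpi_ind=> u; elim/qpi_ind=> v.
by rewrite -linearP !h1E linearP.
Qed.

Definition par_tensor_ext : par_tensor K G -> Y := qlift h1.

Lemma par_tensor_extE (c : KG) (r : A) : par_tensor_ext (qpi _ (tens c r)) = j c ◁ r.
Proof.
rewrite -h1_tens; apply: (qliftE (h := lin_of h1_lin)) => _ [g h z].
rewrite raddfB /= !h1_tens.
case: jP => _ _ /(_ h (sa_elt K g)).
by rewrite regular_ract -sa_eltM !ractM => ->; rewrite subrr.
Qed.

Lemma par_tensor_ext_linear : linear par_tensor_ext.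
Proof.
have extE t : par_tensor_ext (qpi _ t) = h1 t.
  apply: (qliftE (h := lin_of h1_lin)) => _ [g h z].
  have := par_tensor_extE (sa_elt K g) ([h] * z).
  rewrite raddfB /= !h1_tens.
  case: jP => _ _ /(_ h (sa_elt K g)).
  by rewrite regular_ract -sa_eltM !ractM => ->; rewrite subrr.
move=> r u v; rewrite -[r *: u]/(u ◁ r) -[r *: _]/(_ ◁ (r : A)).
elim/qpi_ind: u => u; elim/qpi_ind: v => v.
rewrite par_tensor_ract.
have -> : qpi _ (tens_act r u) + qpi _ v = qpi (@par_tensor_relations K G) (tens_act r u + v).
  by rewrite raddfD.
rewrite !extE.
have hD : {morph h1 : x y / x + y} by move=> x y; have := h1_lin 1 x y; rewrite !scale1r.
rewrite hD; congr (_ + _).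
elim/tensor_ind: u => [|k c z u IH]; first by rewrite tens_act0 (morphD0 hD) ract0l.
rewrite tens_act_lin !h1_lin IH tens_actE !h1_tens !scalar_resE ractDl; congr (_ + _).
by rewrite -!ractM !mul_scal sa_scalerAl.
Qed.

Lemma par_tensor_ext_unit c : par_tensor_ext (par_unit c) = j c.
Proof. by rewrite par_tensor_extE ract1. Qed.

End Extension.

(** The direct sum of copies of KG indexed by P maps onto P, with a section s.
The functor turns this into copies of L mapping onto diag P, with a section.
Both maps come from universal properties, so no basis of L is ever needed. *)
Lemma diag_projective_retract (P : rmodType KG) : projective_module P ->
  stable_retract (diag P) (dsum P (par_tensor K G)).
Proof.
move=> Pp.
pose orbit (q : P) (c : regular) : P := q ◁ (c : KG).
have orbit_lin q : linear (orbit q).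
  by move=> k c d; rewrite /orbit ractDr; congr (_ + _); apply: ractM.
have glue_lin := glue_linear orbit_lin.
have orbitD q : {morph orbit q : c d / c + d} by move=> c d; apply: ractDr.
have [|s sE] := Pp _ _ (lin_of glue_lin) idfun.
  by move=> q; exists (dinj q (1 : KG)); rewrite lin_ofE glue_dinj// /orbit ract1.
have [uD uK uG] := par_unit_compatible.
pose u := add_of uD.
have j_compat : par_compatible (fun p => dmap u (s p) : dsum P (par_tensor K G)).
  split=> [p q|k p|g p]; first by rewrite raddfD dmapD.
    apply/dsumP => t; rewrite (ract_map s) [RHS]dcoefZ !dcoef_dmap [X in u X]dcoefZ.
    exact: uK.
  apply/dsumP => t; rewrite (ract_map s) ![in LHS]dcoefZ [RHS]dcoefZ !dcoef_dmap [X in u X]dcoefZ.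
  exact: uG.
pose m q := par_tensor_ext (fun c : regular => unit_diag (orbit q c)).
have m_compat q : par_compatible (fun c : regular => unit_diag (orbit q c)).
  have [iD iK iG] := unit_diag_compatible P.
  split=> [c d|k c|g c]; first by rewrite orbitD iD.
    by rewrite -iK /orbit regular_ract ractM.
  by rewrite -iG /orbit regular_ract ractM.
have m_lin q : linear (m q) := par_tensor_ext_linear (m_compat q).
have M_lin := glue_linear m_lin.
pose a := lin_of (diag_ext_linear j_compat).
pose b : {linear dsum P (par_tensor K G) -> diag P} := lin_of M_lin.
apply: (retract_stable (a := a) (b := b)) => x.
apply: (@diag_ind_linear _ _ _ _ (b \o a) idfun) => p /=.
rewrite diag_ext_unit //.
rewrite -[in RHS](sE p : glue orbit (s p) = p).
have mD q : {morph m q : x y / x + y} by move=> x1 x2; have := m_lin q 1 x1 x2; rewrite !scale1r.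
elim/dsum_ind: (s p) => [|t c v IH].
  by rewrite (morphD0 (@dmapD _ _ _ u)) !glue0// (morphD0 (@unit_diagD _ _ _)).
rewrite (@dmapD _ _ _ u) !glueD// IH unit_diagD (@dmap_dinj _ _ _ u) !glue_dinj//.
by rewrite /m par_tensor_ext_unit.
Qed.

End ParTensor.

(** * Bounding the partial cohomological dimension *)

Section IdemModule.
Context (K : comPzRingType) (G : groupType).
Local Notation KG := (group_algebra K G).
Local Notation A := (par_algebra K G).
Local Notation B := (idem_algebra K G).
Local Notation "[ g ]" := (sa_elt K (exel_gen g)).
Local Notation e g := (sa_elt K (exel_e g)).

Lemma idem_pred_ind (P : A -> Prop) :
  P 0 -> (forall k x u, exel_idem x -> P u -> P (k *: sa_elt K x + u)) ->
  forall u, u \in @idem_pred K G -> P u.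
Proof.
move=> P0 PD u /idem_predP iu; rewrite (freemodE u) fliftE big_seq.
by apply: big_rec => // x v /iu xx; apply: PD.
Qed.

Lemma idem_val_ract (u : B) (r : A) : idem_val (u ◁ r) = conj_act (idem_val u) r.
Proof. by []. Qed.

Lemma idem_one_subproof : (1 : A) \in @idem_pred K G.
Proof.
apply/idem_predP => x; rewrite mem_supp -sa_elt1 coef_single.
by case: (eqVneq x) => [-> _|]; [exact: exel_idem1|rewrite eqxx].
Qed.

Definition idem_one : B := IdemAlgebra idem_one_subproof.

Lemma idem_one_ract (u : B) : idem_one ◁ idem_val u = u.
Proof.
apply: val_inj; apply: etrans (idem_val_ract _ _) _.
apply: (@idem_pred_ind (fun v => conj_act 1 v = v) _ _ _ (idem_valP u)) => [|k x v xx IH];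
  first exact: conj_act0r.
by rewrite conj_act_linr IH conj_act_elt mulr1 (exel_idemV xx) -sa_eltM xx.
Qed.

Lemma idem_one_gen g : idem_one ◁ e g^-1%g = idem_one ◁ [g].
Proof.
apply: val_inj; apply: etrans (idem_val_ract _ _) (etrans _ (esym (idem_val_ract _ _))).
rewrite !conj_act_elt !mulr1.
by rewrite -!sa_eltM exel_eV exel_e_idem exel_genV exel_eE.
Qed.

Local Notation triv := (trivial_module K G : rmodType KG).

Lemma trivial_ract_elt (p : triv) g : p ◁ sa_elt K g = p.
Proof. by apply: etrans (congr1 ( *%R (p : K)) (augmentation_elt K g)) (mulr1 _). Qed.

Lemma trivial_ract_scal (p : triv) k : p ◁ scal _ k = (p : K) * k.
Proof.
apply: (congr1 ( *%R (p : K))).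
by rewrite /scal -[_ *: _]addr0 augmentation_lin augmentation0 addr0 augmentation_elt mulr1.
Qed.

(** The two maps are u |-> (1 (x) 1) u and k (x) t |-> k t.  The first one is
linear because x^-1 t x and t x act in the same way on 1 (x) 1, for every
idempotent t: both send it to 1 (x) x^-1 t x. *)
Lemma idem_algebra_retract : stable_retract (B : rmodType A) (diag triv).
Proof.
pose j (k : triv) : B := idem_one ◁ scal _ (k : K).
have j_compat : par_compatible j.
  split=> [p q|k p|g p].
  - by rewrite /j -ractDr /scal scalerDl.
  - by rewrite /j trivial_ract_scal scalM ractM.
  - by rewrite /j trivial_ract_elt -!ractM -!scalC !ractM idem_one_gen.
pose w : diag triv := unit_diag ((1 : K) : triv).
have wE (u : A) (r : A) : u \in @idem_pred K G -> w ◁ conj_act u r = w ◁ (u * r).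
  move=> iu; elim/sa_ind: r => [|k x r IH]; first by rewrite conj_act0r mulr0.
  rewrite conj_act_linr sa_linr !ract_lin IH conj_act_elt; congr (_ ◁ _ + _).
  apply: (@idem_pred_ind (fun u =>
    w ◁ (sa_elt K x^-1%g * u * sa_elt K x) = w ◁ (u * sa_elt K x)) _ _ u) =>
    // [|l t v tt IHu]; first by rewrite mulr0 !mul0r.
  rewrite sa_linr !sa_linl !ract_lin IHu -!sa_eltM; congr (_ ◁ _ + _).
  rewrite 2!unit_diag_elt 2!trivial_ract_elt; congr (dinj _ _); apply: val_inj => /=.
  rewrite (exel_idemV (exel_idem_conj x tt)) !mulg1 (exel_idem_conj x tt).
  by rewrite invgM (exel_idemV tt) !mulgA -(mulgA _ t t) tt.
have a_lin : linear (fun u : B => w ◁ idem_val u).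
  move=> r u v; rewrite idem_valD ractDr; congr (_ + _).
  by rewrite -[r *: u]/(u ◁ r) idem_val_ract wE ?idem_valP// ractM.
apply: (retract_stable (a := lin_of a_lin) (b := lin_of (diag_ext_linear j_compat))) => u.
rewrite -[LHS]/(lin_of (diag_ext_linear j_compat) (w ◁ idem_val u)) ract_map /= diag_ext_unit //.
by rewrite /j /scal scale1r ract1 idem_one_ract.
Qed.

(** Induction on n along a syzygy N of X: the sequence of diag N, diag P and
diag X raises the bound for diag N by one, and diag P is bounded by m. *)
Lemma pdle_diag n m (X : rmodType KG) :
  pdle m (par_tensor K G : rmodType A) -> pdle n X -> pdle (n + m) (diag X).
Proof.
move=> Lm; have diagP (P : rmodType KG) : projective_module P -> pdle m (diag P).
  by move=> Pp; apply: pdle_stable_retract (diag_projective_retract Pp) _; apply: pdle_dsum.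
elim: n X => [|n IH] X /=; first exact: diagP.
move=> [N [P [i [p [Pp ip /IH Nn]]]]].
apply: (pdle_quotient (diag_exact ip)) => //.
by apply: pdle_leq (diagP _ Pp); rewrite leqW// leq_addl.
Qed.

Lemma pdle_idem_algebra n m : pdle n triv -> pdle m (par_tensor K G : rmodType A) ->
  pdle (n + m) (B : rmodType A).
Proof.
by move=> Kn Lm; apply: pdle_stable_retract idem_algebra_retract _; apply: pdle_diag.
Qed.

End IdemModule.

Section CountableTensor.
Context (K : comPzRingType) (G : groupType).
Local Notation KG := (group_algebra K G).
Local Notation A := (par_algebra K G).
Local Notation "[ g ]" := (sa_elt K (exel_gen g)).
Local Notation e g := (sa_elt K (exel_e g)).

Lemma par_tensor_ind_linear (Y : rmodType A) (f f' : {linear par_tensor K G -> Y}) :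
  (forall g, f (par_unit (sa_elt K g)) = f' (par_unit (sa_elt K g))) -> f =1 f'.
Proof.
move=> ff' x; elim/qpi_ind: x => t; elim/tensor_ind: t => [|k c z t IH].
  by rewrite raddf0 !raddf0.
rewrite raddfD !raddfD /= {}IH; congr (_ + _).
have -> : qpi (@par_tensor_relations K G) (k *: tens c z) = par_unit (k *: c : KG) ◁ z.
  have := tens_linl k c 0 z; rewrite addr0.
  have -> : tens (0 : KG) z = 0.
    have := tens_linl 1 (0 : KG) 0 z; rewrite !scale1r addr0 => /eqP.
    by rewrite -subr_eq subrr eq_sym => /eqP.
  by rewrite addr0 par_unit_ract => <-.
rewrite !ract_map; congr (_ ◁ _).
elim/sa_ind: (k *: c : KG) => [|l g d IH].
  by rewrite (morphD0 (@par_unitD K G)) !raddf0.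
by rewrite par_unit_lin !raddfD /= !ract_map ff' IH.
Qed.

Lemma gen_eK (h : G) : [h] * e h^-1%g = [h].
Proof. by rewrite -sa_eltM /exel_e invgK mulgA exel_genK. Qed.

Lemma e_genV (h : G) : e h^-1%g * [h^-1%g] = [h^-1%g].
Proof. by rewrite -sa_eltM /exel_e exel_genK. Qed.

Section Lifting.
Context (X Y : rmodType A) (p : {linear X -> Y}) (p_surj : surj p).
Context (enum : nat -> G) (y : nat -> Y).
Local Notation q i j := ((enum i)^-1 * enum j)%g.

(** The relations between the generators g (x) 1 of L, read along an enumeration
of G.  Repetitions in the enumeration are harmless, since these relations make
the corresponding terms equal. *)
Definition consistent (V : rmodType A) (n : nat) (x : nat -> V) : Prop :=
  forall i j, (i < n)%N -> (j < n)%N -> x i ◁ e (q i j) = x j ◁ [q j i].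

Hypothesis y_cons : forall n, consistent n y.

Lemma qV i j : (q i j)^-1%g = q j i.
Proof. by rewrite invgM invgK. Qed.

(** The values that lift_step prescribes on the idempotents e (q k i) and
e (q k j) agree on their product, the overlap of the two parts. *)
Lemma consistent_glue (V : rmodType A) n (x : nat -> V) i j k : consistent n x ->
  (i < n)%N -> (j < n)%N -> x i ◁ [q i k] ◁ e (q k j) = x j ◁ [q j k] ◁ e (q k i).
Proof.
have move_e a b : [q a k] * e (q k b) = e (q a b) * [q a k].
  by rewrite -!sa_eltM exel_gen_e (mulgA _ _ (enum b)) mulgK.
move=> xc ltin ltjn; rewrite -!ractM !move_e !ractM xc//.
by rewrite -!ractM -!sa_eltM exel_genM (mulgA _ _ (enum k)) mulgK.
Qed.

(** As for functions on a space covered by clopen pieces, a value prescribed on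
the part of an idempotent e is imposed on v by passing to v - v e + c.  This
does not disturb the conditions already imposed, as the prescribed values agree
on overlaps, nor the image under p, as y satisfies the same relations. *)
Lemma lift_step n (x : nat -> X) : consistent n x -> (forall i, (i < n)%N -> p (x i) = y i) ->
  exists v, p v = y n /\ forall i, (i < n)%N -> v ◁ e (q n i) = x i ◁ [q i n].
Proof.
move=> xc px.
(* The conditions are imposed one by one, those of index below k at stage k. *)
suff: forall k, (k <= n)%N ->
    exists v, p v = y n /\ forall i, (i < k)%N -> v ◁ e (q n i) = x i ◁ [q i n].
  by apply.
elim=> [_|k IH ltkn]; first by have [v pv] := p_surj (y n); exists v.
have [v [pv vE]] := IH (ltnW ltkn).
exists (v - v ◁ e (q n k) + x k ◁ [q k n]); split=> [|i].
  rewrite linearD linearB !(ract_map p) pv px// (@y_cons n.+1)//; last exact: ltnW.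
  by rewrite subrK.
have eK : e (q n k) * e (q n k) = e (q n k) by rewrite -sa_eltM exel_e_idem.
have xK : x k ◁ [q k n] ◁ e (q n k) = x k ◁ [q k n].
  by rewrite -ractM -(qV k n) gen_eK.
rewrite ltnS leq_eqVlt => /predU1P[->|ltik].
  by rewrite ractDl ractBl -ractM eK subrr add0r xK.
have ltin := ltn_trans ltik ltkn.
rewrite ractDl ractBl -ractM.
have -> : e (q n k) * e (q n i) = e (q n i) * e (q n k) by rewrite -!sa_eltM exel_eC.
by rewrite ractM vE// (consistent_glue _ xc ltin ltkn) subrK.
Qed.

Lemma consistent_lift : exists x : nat -> X,
  (forall n, consistent n x) /\ forall n, p (x n) = y n.
Proof.
pose good n x := consistent n x /\ forall i, (i < n)%N -> p (x i) = y i.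
(* F extends any consistent lift of the first n terms by one term; its value is
   irrelevant on other families. *)
have /choice[F FE] : forall nx : nat * (nat -> X), exists v, good nx.1 nx.2 ->
    p v = y nx.1 /\ forall i, (i < nx.1)%N -> v ◁ e (q nx.1 i) = nx.2 i ◁ [q i nx.1].
  move=> [n x] /=; have [[xc px]|ngood] := pselect (good n x); last by exists 0.
  by have [v vE] := lift_step xc px; exists v.
have [s sS] : exists s : nat -> nat -> X,
    forall n i, s n.+1 i = if i == n then F (n, s n) else s n i.
  by exists (fix s n := if n is n'.+1 then
    fun i => if i == n' then F (n', s n') else s n' i else fun=> 0).
have sn n : s n.+1 n = F (n, s n) by rewrite sS eqxx.
have s_lt n i : (i < n)%N -> s n.+1 i = s n i by move=> ltin; rewrite sS (ltn_eqF ltin).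
have s_good n : good n (s n).
  elim: n => [|n IH]; first by split.
  have [pF FC] := FE (n, s n) IH; have [sc ps] := IH.
  split=> [i j|i]; rewrite [(i < _)%N]ltnS leq_eqVlt; last first.
    by move=> /predU1P[->|lti]; rewrite ?sn// s_lt// ps.
  rewrite [(j < _)%N]ltnS [(j <= _)%N]leq_eqVlt => /predU1P[->|lti] /predU1P[->|ltj].
  - by rewrite mulVg exel_gen1 /exel_e invg1 exel_gen1 mulg1.
  - by rewrite sn s_lt// FC.
  - rewrite sn s_lt// -(qV i n) -[in RHS]e_genV ractM (qV i n) FC// -ractM.
    by rewrite -sa_eltM -(qV i n).
  - by rewrite !s_lt// sc.
have sE n i : (i < n)%N -> s n i = s i.+1 i.
  elim: n => // n IH; rewrite ltnS leq_eqVlt => /predU1P[-> //|ltin].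
  by rewrite s_lt// IH.
exists (fun i => s i.+1 i); split=> [n i j ltin ltjn|n].
  by rewrite -!(sE n)//; apply: (s_good n).1.
by apply: (s_good n.+1).2.
Qed.

End Lifting.

Lemma countable_enum : countable [set: G] -> exists enum : nat -> G, surj enum.
Proof.
move=> /countable_injP[f f_inj].
have /choice[enum enumE] : forall n, exists g, forall h, f h = n -> h = g.
  move=> n; have [[g gn]|no] := pselect (exists g, f g = n).
    by exists g => h hn; apply: f_inj; rewrite ?inE// hn gn.
  by exists 1%g => h hn; case: no; exists h.
by exists enum => g; exists (f g); apply/esym/enumE.
Qed.

(** With an enumeration of G, each generator of L has only finitely many
predecessors, so lift_step can be iterated. *)
Lemma par_tensor_projective : countable [set: G] ->
  projective_module (par_tensor K G : rmodType A).
Proof.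
move=> /countable_enum[enum enum_surj] X Y p f p_surj.
have [uD uK uG] := @par_unit_compatible K G.
pose y n : Y := f (par_unit (sa_elt K (enum n))).
have y_cons n : consistent enum n y.
  move=> i j _ _; rewrite /y -!ract_map; congr (f _).
  rewrite -(uG _ (sa_elt K (enum j))) regular_ract -sa_eltM mulgA mulgV mul1g.
  by rewrite invgM invgK.
have [x [xc px]] := consistent_lift p_surj y_cons.
have /choice[idx idxE] := enum_surj.
pose j : regular K G -> X := flift (fun g => x (idx g) : scalar_res X).
have j_lin (k : K) (c d : KG) : j (k *: c + d) = j c ◁ scal _ k + j d by rewrite /j linearP.
have jD : {morph j : c d / c + d}.
  by move=> c d; have := j_lin 1 c d; rewrite /scal !scale1r ract1.
have j_elt g : j (sa_elt K g) = x (idx g) by rewrite /j flift_single.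
have j_compat : par_compatible j.
  split=> [//|k c|g c].
    by have := j_lin k c 0; rewrite addr0 (morphD0 jD) addr0 regular_ract mul_scal.
  rewrite regular_ract; elim/sa_ind: (c : KG) => [|k h d IH].
    by rewrite mul0r (morphD0 jD) !ract0l.
  rewrite sa_linl !j_lin !ractDl IH -!ractM -!scalC !ractM; congr (_ ◁ _ + _).
  rewrite -sa_eltM !j_elt.
  have := xc (maxn (idx (h * g)%g) (idx h)).+1 (idx (h * g)%g) (idx h).
  rewrite !ltnS leq_maxl leq_maxr !idxE => /(_ isT isT).
  by rewrite invgM mulgVK mulKg.
exists (lin_of (par_tensor_ext_linear j_compat)).
apply: (@par_tensor_ind_linear _ (p \o lin_of (par_tensor_ext_linear j_compat)) f) => g /=.
by rewrite par_tensor_ext_unit // j_elt px /y idxE.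
Qed.

End CountableTensor.

(** * Localization: from partial modules back to KG-modules *)

Section InducedLinear.
Context (R : pzRingType) (V W : lmodType R) (S : set V) (h : {linear V -> W}).
Hypothesis hS : forall s, S s -> h s = 0.

Lemma qlift_linear : linear (qlift h : quotmod S -> W).
Proof.
move=> k; elim/qpi_ind=> u; elim/qpi_ind=> v.
by rewrite -linearP /= !qliftE// linearP.
Qed.

End InducedLinear.

Section Degree.
Context (K : comPzRingType) (G : groupType).
Local Notation KG := (group_algebra K G).
Local Notation A := (par_algebra K G).
Local Notation "[ g ]" := (sa_elt K (exel_gen g)).

Definition deg_alg : A -> KG := flift (fun x => sa_elt K (exel_deg x)).
Definition gen_alg : KG -> A := flift (fun g => [g]).

Lemma deg_alg_lin k (r s : A) : deg_alg (k *: r + s) = k *: deg_alg r + deg_alg s.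
Proof. exact: linearP. Qed.
Lemma gen_alg_lin k (c d : KG) : gen_alg (k *: c + d) = k *: gen_alg c + gen_alg d.
Proof. exact: linearP. Qed.
Lemma deg_alg0 : deg_alg 0 = 0. Proof. exact: raddf0. Qed.
Lemma gen_alg0 : gen_alg 0 = 0. Proof. exact: raddf0. Qed.
Lemma deg_alg_elt x : deg_alg (sa_elt K x) = sa_elt K (exel_deg x).
Proof. exact: flift_single. Qed.
Lemma gen_alg_elt g : gen_alg (sa_elt K g) = [g]. Proof. exact: flift_single. Qed.

Lemma deg_algM r s : deg_alg (r * s) = deg_alg r * deg_alg s.
Proof.
elim/sa_ind: r s => [|k x r IH] s; first by rewrite mul0r deg_alg0 mul0r.
rewrite sa_linl !deg_alg_lin sa_linl IH; congr (_ *: _ + _).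
elim/sa_ind: s => [|l y s IHs]; first by rewrite mulr0 deg_alg0 mulr0.
by rewrite sa_linr !deg_alg_lin sa_linr IHs -sa_eltM !deg_alg_elt exel_degM sa_eltM.
Qed.

Lemma deg_alg1 : deg_alg 1 = 1.
Proof. by rewrite -sa_elt1 deg_alg_elt exel_deg1. Qed.

Lemma deg_alg_scal k : deg_alg (scal _ k) = scal _ k.
Proof. by rewrite {1}/scal -[k *: _]addr0 deg_alg_lin deg_alg0 addr0 deg_alg1. Qed.

Lemma gen_alg_scal k : gen_alg (scal _ k) = scal _ k.
Proof.
by rewrite {1}/scal -[k *: _]addr0 gen_alg_lin gen_alg0 addr0 gen_alg_elt exel_gen1.
Qed.

Lemma gen_algK : cancel gen_alg deg_alg.
Proof.
elim/sa_ind=> [|k g c IH]; first by rewrite gen_alg0 deg_alg0.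
by rewrite gen_alg_lin deg_alg_lin IH gen_alg_elt deg_alg_elt exel_deg_gen.
Qed.

(** Restriction of scalars along the degree map [g] |-> g. *)
Definition par_res (X : rmodType KG) : Type := X.

Section Restriction.
Context (X : rmodType KG).

HB.instance Definition _ := GRing.Zmodule.on (par_res X).

Definition par_res_scale (r : A^c) (x : par_res X) : par_res X := (x : X) ◁ deg_alg r.

Fact par_res_scaleA a b x : par_res_scale a (par_res_scale b x) = par_res_scale (a * b) x.
Proof. by rewrite /par_res_scale -ractM -deg_algM. Qed.
Fact par_res_scale1 : left_id 1 par_res_scale.
Proof. by move=> x; rewrite /par_res_scale deg_alg1 ract1. Qed.
Fact par_res_scaleDr : right_distributive par_res_scale +%R.
Proof. by move=> r x y; apply: ractDl. Qed.
Fact par_res_scaleDl x : {morph par_res_scale^~ x : a b / a + b}.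
Proof.
move=> a b; rewrite /par_res_scale -ractDr; congr (_ ◁ _).
by have := deg_alg_lin 1 a b; rewrite !scale1r.
Qed.

HB.instance Definition _ := GRing.Zmodule_isLmodule.Build A^c (par_res X)
  par_res_scaleA par_res_scale1 par_res_scaleDr par_res_scaleDl.

Lemma par_res_ract (x : par_res X) r : x ◁ r = (x : X) ◁ deg_alg r. Proof. by []. Qed.

End Restriction.
End Degree.

Section Localization.
Context (K : comPzRingType) (G : groupType).
Local Notation KG := (group_algebra K G).
Local Notation A := (par_algebra K G).
Local Notation "[ g ]" := (sa_elt K (exel_gen g)).
Local Notation e g := (sa_elt K (exel_e g)).
Local Notation ep s := (sa_elt K (exel_eprod s)).

(** The kernel of M -> M (x)_A KG.  Tensoring with KG makes every e_g act as the
identity, and since these are commuting idempotents, an element becomes zero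
exactly if some finite product of them kills it. *)
Definition torsion (M : rmodType A) : set M := [set m | exists s : seq G, m ◁ ep s = 0]%classic.
Arguments torsion : clear implicits.

Definition localization (M : rmodType A) : Type := quotmod (torsion M).

Section Structure.
Context (M : rmodType A).
Local Notation T := (torsion M).
Local Notation Q := (quotmod T).

Lemma torsion_submod : is_submodule T.
Proof.
have TD u v : T u -> T v -> T (u + v).
  move=> [s us] [t vt]; exists (s ++ t); rewrite ractDl exel_eprod_cat.
  rewrite {2}(exel_idemC (exel_eprod_idem s) (exel_eprod_idem t)) !sa_eltM !ractM us vt.
  by rewrite !ract0l addr0.
have TK k u : T u -> T (u ◁ scal _ k).
  by move=> [s us]; exists s; rewrite -ractM -scalC ractM us ract0l.
(* Right multiplication by [g] moves the product of the e_a to the product of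
   the e_(g^-1 a). *)
have TM x u : T u -> T (u ◁ sa_elt K x).
  elim/exel_ind: x u => [|g x IH] u Tu; first by rewrite sa_elt1 ract1.
  rewrite sa_eltM ractM; apply: IH; case: Tu => s us.
  exists [seq (g^-1 * a)%g | a <- s]; rewrite -ractM -sa_eltM exel_gen_eprod.
  by rewrite (mapK (mulVKg g)) sa_eltM ractM us ract0l.
have T0 : T 0 by exists [::]; rewrite ract0l.
split=> // r u v Tu Tv; apply: (TD) => //; rewrite -[r *: u]/(u ◁ r).
elim/sa_ind: (r : A) => [|k x a IH]; first by rewrite ract0.
by rewrite ract_lin; apply: (TD) => //; apply/TK/TM.
Qed.

Lemma qpi_torsion (m : M) : qpi T m = 0 <-> exists s : seq G, m ◁ ep s = 0.
Proof.
split=> [/qpi0|mT]; last by apply/qpi0; apply: Defs.sub_span.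
by move/(span_min torsion_submod); apply.
Qed.

Lemma qpi_ep (x : Q) s : x ◁ ep s = x.
Proof.
elim/qpi_ind: x => m; apply/eqP; rewrite -ract_map -subr_eq0 -raddfB; apply/eqP.
by apply/qpi_torsion; exists s; rewrite ractBl -ractM -sa_eltM exel_eprod_idem subrr.
Qed.

HB.instance Definition _ := GRing.Zmodule.on (localization M).

(** An action of the group because [g] [h] = e_g [g h] and e_g acts as the
identity on the quotient. *)
Definition loc_scale (c : KG^c) (x : localization M) : localization M := (x : Q) ◁ gen_alg c.

Lemma ract_gen_alg (x : Q) (r : A) : x ◁ gen_alg (deg_alg r) = x ◁ r.
Proof.
elim/sa_ind: r => [|k y r IH]; first by rewrite deg_alg0 gen_alg0.
rewrite deg_alg_lin gen_alg_lin !ract_lin IH deg_alg_elt gen_alg_elt; congr (_ ◁ _ + _).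
have [s [h yE]] := exel_normal y.
rewrite yE exel_degM exel_deg_eprod exel_deg_gen mul1g sa_eltM.
by rewrite [RHS]ractM qpi_ep.
Qed.

Fact loc_scaleA a b x : loc_scale a (loc_scale b x) = loc_scale (a * b) x.
Proof.
rewrite /loc_scale -ractM -[LHS]ract_gen_alg deg_algM !gen_algK.
by rewrite -[a * b]/((b : KG) * (a : KG)).
Qed.
Fact loc_scale1 : left_id 1 loc_scale.
Proof.
move=> x; apply: etrans (congr1 (ract (x : Q)) (_ : gen_alg 1 = 1)) (ract1 _).
by rewrite -sa_elt1 gen_alg_elt exel_gen1.
Qed.
Fact loc_scaleDr : right_distributive loc_scale +%R.
Proof. by move=> r x y; apply: ractDl. Qed.
Fact loc_scaleDl x : {morph loc_scale^~ x : a b / a + b}.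
Proof.
move=> a b; rewrite /loc_scale -ractDr; congr (_ ◁ _).
by have := gen_alg_lin 1 a b; rewrite !scale1r.
Qed.

HB.instance Definition _ := GRing.Zmodule_isLmodule.Build KG^c (localization M)
  loc_scaleA loc_scale1 loc_scaleDr loc_scaleDl.

Lemma loc_ract (x : localization M) (c : KG) : x ◁ c = (x : Q) ◁ gen_alg c. Proof. by []. Qed.

End Structure.

Section Functor.
Context (M N : rmodType A) (f : {linear M -> N}).

Definition loc_map : localization M -> localization N := qlift (qpi (torsion N) \o f).

Let torsion_map m : torsion M m -> (qpi (torsion N) \o f) m = 0.
Proof.
by move=> [s ms] /=; apply/qpi_torsion; exists s; rewrite -ract_map ms raddf0.
Qed.

Lemma loc_map_pi m : loc_map (qpi (torsion M) m) = qpi (torsion N) (f m).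
Proof. exact: (qliftE (h := qpi (torsion N) \o f)). Qed.

Lemma loc_map_linear : linear loc_map.
Proof.
have lin := qlift_linear torsion_map.
move=> c u v; rewrite -[c *: u]/((u : quotmod _) ◁ gen_alg c).
exact: lin.
Qed.

End Functor.

(** An equality in a localization holds in the module after multiplication by a
finite product of the e_g, and this multiplication does not change the classes
of the elements involved. *)
Lemma loc_exact (N P M : rmodType A) (i : {linear N -> P}) (p : {linear P -> M}) :
  short_exact i p -> short_exact (lin_of (loc_map_linear i)) (lin_of (loc_map_linear p)).
Proof.
move=> [i_inj ipE p_surj]; split.
- move=> x y /eqP; rewrite -subr_eq0 -raddfB => /eqP ixy.
  apply/eqP; rewrite -subr_eq0; apply/eqP; move: ixy.
  elim/qpi_ind: (x - y) => n; rewrite /= loc_map_pi => /qpi_torsion[s].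
  rewrite -ract_map -[X in _ = X](raddf0 i) => /i_inj ns.
  by apply/qpi_torsion; exists s.
- elim/qpi_ind=> x; split=> [|[y <-]].
    rewrite /= loc_map_pi => /qpi_torsion[s]; rewrite -ract_map => /ipE[n nE].
    exists (qpi _ n); rewrite /= loc_map_pi nE; apply: etrans (qpi_ep _ s).
    exact: (ract_map (qpi (torsion P))).
  elim/qpi_ind: y => n; rewrite /= !loc_map_pi.
  have -> : p (i n) = 0 by apply/ipE; exists n.
  exact: raddf0.
- elim/qpi_ind=> m; have [x <-] := p_surj m.
  by exists (qpi _ x); rewrite /= loc_map_pi.
Qed.

(** Localization is left adjoint to restriction of scalars, which preserves
surjections. *)
Lemma loc_projective (P : rmodType A) :
  projective_module P -> projective_module (localization P : rmodType KG).
Proof.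
move=> Pp X Y p f p_surj.
have p_lin : linear (p : par_res X -> par_res Y).
  move=> r u v; rewrite linearD; congr (_ + _); exact: (ract_map p).
have f_lin : linear (fun m : P => f (qpi (torsion P) m) : par_res Y).
  move=> r u v; rewrite linearP [LHS](raddfD f); congr (_ + _).
  apply: etrans (ract_map f (qpi (torsion P) u : localization P) (deg_alg r)).
  by rewrite loc_ract ract_gen_alg.
have [g gE] := Pp _ _ (lin_of p_lin) (lin_of f_lin) p_surj.
have g0 m : torsion P m -> g m = 0.
  move=> [s ms]; have := congr1 g ms; rewrite ract_map raddf0 par_res_ract.
  by rewrite deg_alg_elt exel_deg_eprod sa_elt1 ract1.
have h_lin := qlift_linear g0.
have h_KG : linear (qlift g : localization P -> X).
  move=> c u v; have := h_lin (gen_alg c) u v.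
  by rewrite [X in _ = X + _ -> _]/((_ : X) ◁ deg_alg (gen_alg c)) gen_algK.
exists (lin_of h_KG); elim/qpi_ind=> m /=.
by rewrite qliftE //; apply: gE.
Qed.

Lemma pdle_loc n (M : rmodType A) : pdle n M -> pdle n (localization M : rmodType KG).
Proof.
elim: n M => [|n IH] M /=; first exact: loc_projective.
move=> [N [P [i [p [Pp ip /IH Nn]]]]].
exists (localization N), (localization P), (lin_of (loc_map_linear i)), (lin_of (loc_map_linear p)).
by split=> //; [exact: loc_projective|exact: loc_exact].
Qed.

Local Notation B := (idem_algebra K G).
Local Notation triv := (trivial_module K G : rmodType KG).

(** The sum of the coefficients of u in B is invariant under the action, which
is by conjugation, hence a map from the localization of B onto K; it is split by
k |-> k 1. *)
Lemma trivial_retract : stable_retract triv (localization (B : rmodType A)).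
Proof.
pose h (u : B) : par_res triv := augmentation (deg_alg (idem_val u)).
have hD : {morph h : u v / u + v}.
  move=> u v; rewrite /h idem_valD.
  have := deg_alg_lin 1 (idem_val u) (idem_val v); rewrite !scale1r => ->.
  have := augmentation_lin 1 (deg_alg (idem_val u)) (deg_alg (idem_val v)).
  by rewrite scale1r mul1r.
have h_lin : linear h.
  apply: semigroup_linear => [//|k u|x u].
    rewrite par_res_ract deg_alg_scal trivial_ract_scal /h idem_val_ract.
    rewrite /scal -[k *: _]addr0 conj_act_linr conj_act0r addr0 conj_act1.
    rewrite -mul_scal deg_algM deg_alg_scal augmentationM; congr (_ * _).
    by rewrite /scal -[k *: _]addr0 augmentation_lin augmentation0 addr0 augmentation_elt mulr1.
  rewrite par_res_ract /h idem_val_ract deg_alg_elt trivial_ract_elt conj_act_elt.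
  by rewrite !deg_algM !augmentationM !deg_alg_elt !augmentation_elt mul1r mulr1.
have h0 u : torsion B u -> lin_of h_lin u = 0.
  move=> [s us]; have := congr1 (lin_of h_lin) us.
  rewrite ract_map raddf0 par_res_ract deg_alg_elt exel_deg_eprod.
  by rewrite trivial_ract_elt.
have b_lin' := qlift_linear h0.
have b_lin : linear (qlift (lin_of h_lin) : localization B -> triv).
  move=> c u v; have := b_lin' (gen_alg c) u v.
  by rewrite [X in _ = X + _ -> _]/((_ : triv) ◁ deg_alg (gen_alg c)) gen_algK.
pose a0 (k : triv) : localization B := qpi (torsion B) (idem_one K G ◁ scal _ (k : K)).
have a_lin : linear a0.
  apply: semigroup_linear => [p q|k p|g p]; rewrite ?loc_ract /a0.
  - by rewrite /scal scalerDl ractDr raddfD.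
  - by rewrite trivial_ract_scal gen_alg_scal scalM ractM ract_map.
  - rewrite trivial_ract_elt gen_alg_elt -(ract_map (qpi (torsion B))) -ractM -scalC ractM.
    rewrite -idem_one_gen -ractM scalC ractM.
    have := qpi_ep (qpi (torsion B) (idem_one K G ◁ scal _ (p : K))) [:: g^-1%g].
    by rewrite /= mulg1 => {1}<-; rewrite -(ract_map (qpi (torsion B))).
apply: (retract_stable (a := lin_of a_lin) (b := lin_of b_lin)) => k.
apply: etrans (qliftE (h := lin_of h_lin) h0 _) _.
rewrite (ract_map (lin_of h_lin)) par_res_ract deg_alg_scal trivial_ract_scal.
by rewrite [X in X * _](_ : _ = 1) ?mul1r// /h /= deg_alg1 augmentation_elt.
Qed.

Lemma pdle_trivial n : pdle n (B : rmodType A) -> pdle n triv.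
Proof. by move=> /pdle_loc; apply: pdle_stable_retract trivial_retract. Qed.

End Localization.

(** * Comparison of the dimensions *)

Section ProjectiveDimensionValue.
Context (R : pzRingType) (M : lmodType R).

Lemma projdim_spec :
  (exists n, [/\ projdim M = (Posz n)%:E, pdle n M & forall m, pdle m M -> (n <= m)%N]) \/
  (projdim M = +oo%E /\ forall n, ~ pdle n M).
Proof.
rewrite /projdim; case: pselect => [ex|nex]; [left|right].
  case: ex_minnP => n /asboolP/resolution_pdle Mn n_min; exists n; split=> // m Mm.
  exact/n_min/asboolP/pdle_resolution.
by split=> // n Mn; apply: nex; exists n; apply/asboolP/pdle_resolution.
Qed.

Lemma projdim_le n : pdle n M -> (projdim M <= (Posz n)%:E)%E.
Proof.
by case: projdim_spec => [[m [-> _ m_min]]|[_ no]] Mn; [rewrite lee_fin; apply: m_min|case: (no n)].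
Qed.

End ProjectiveDimensionValue.

Lemma eq_projdim (R R' : pzRingType) (M : lmodType R) (M' : lmodType R') :
  (forall n, pdle n M <-> pdle n M') -> projdim M = projdim M'.
Proof.
move=> MM'; case: (projdim_spec M) => [[n [-> /MM' Mn n_min]]|[-> no]].
  case: (projdim_spec M') => [[n' [-> /MM' Mn' n_min']]|[_ /(_ _ Mn)//]].
  by congr (Posz _)%:E; apply/eqP; rewrite eqn_leq n_min// n_min'.
by case: (projdim_spec M') => [[n [_ /MM'/no]]|[->]].
Qed.

Local Open Scope classical_set_scope.
Local Open Scope ereal_scope.

Unset Implicit Arguments.

Theorem corollary3p25 (K : comPzRingType) (G : groupType) :
  (countable [set: G] -> par_cd K G = cd K G) /\
  (~ countable [set: G] -> par_cd K G <= cd K G + pd_par_tensor K G).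
Proof.
split=> [G_count|_].
  apply: eq_projdim => n; split=> [|Kn]; first exact: pdle_trivial.
  rewrite -[n]addn0; apply: pdle_idem_algebra => //.
  exact: par_tensor_projective.
rewrite /par_cd /cd /pd_par_tensor.
case: (projdim_spec (trivial_module K G : rmodType (group_algebra K G))) => [[n [-> Kn _]]|[-> _]];
  case: (projdim_spec (par_tensor K G : rmodType (par_algebra K G))) => [[m [-> Lm _]]|[-> _]].
- by have := projdim_le (pdle_idem_algebra Kn Lm).
- by rewrite addeC leey.
- by rewrite leey.
- by rewrite leey.
Qed.
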